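(* Let $\Phi:(0,+\infty)\to\mathbb{R}$ be convex and satisfy the growth condition $G(\Phi)$, and set $\Phi(0)=\lim_{y\downarrow 0}\Phi(y)$. If $\Phi(0)<+\infty$, $M_\Phi\cap\mathbb{P}\neq\varnothing$ and $f\in\bigcap_{Q\in M_\Phi}L^1(Q)$, then $$\hat f_\Phi := \inf\Big\{x\in\mathbb{R} \,\Big|\, f-x\in\bigcap_{Q\in M_\Phi}\overline{K-L^1_+(Q)}^{Q}\Big\}=\sup_{Q\in M_\Phi}E_Q[f]\le \hat f,$$ where $\hat f=\inf\{x\in\mathbb{R}\mid f-x\in K-L^0_+\}$.
   Context: Setting: $(\Omega,\mathcal{F},(\mathcal{F}_t)_{t\in[0,T]},P)$ is a filtered probability space whose filtration satisfies the usual conditions (right continuity and completeness). $\mathbb{P}$ is the class of probability measures on $\mathcal{F}$ equivalent to $P$. $X=(X_t)_{t\in[0,T]}$ is an $\mathbb{R}^d$-valued càdlàg semimartingale. An $\mathbb{R}^d$-valued predictable process $H$ is called admissible if it is $X$-integrable and there is a constant $c\in\mathbb{R}$ such that for all $t\in[0,T]$, $\int_0^t H_s\cdot dX_s\ge -c$ $P$-a.s. $L^0$ is the space of ($P$-a.s. equivalence classes of) $P$-a.s. finite random variables on $(\Omega,\mathcal{F})$, $L^0_+$ its cone of $P$-a.s. nonnegative elements. $K=\{\int_0^T H_s\cdot dX_s \mid H \text{ admissible}\}\subseteq L^0$, and $K-L^0_+=\{f\in L^0: \exists g\in K,\ g\ge f\ P\text{-a.s.}\}$. $M_1$ is the set of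 probability measures $Q\ll P$ such that $K\subseteq L^1(Q)$ and $E_Q[g]\le 0$ for all $g\in K$. $M_\Phi=\{Q\in M_1: \Phi(dQ/dP)\in L^1(P)\}$, where $\Phi$ is extended to $0$ by $\Phi(0)=\lim_{y\downarrow0}\Phi(y)$. For $Q\in M_1$, $L^1_+(Q)$ is the cone of $Q$-a.s. nonnegative elements of $L^1(Q)$, $K-L^1_+(Q)=\{g-h: g\in K, h\in L^1_+(Q)\}\subseteq L^1(Q)$, and $\overline{A}^{Q}$ denotes the closure of $A\subseteq L^1(Q)$ in the $L^1(Q)$-norm. The element $f$ is a random variable in $L^0$ that is $Q$-integrable for every $Q\in M_\Phi$. Convention: $\inf\varnothing=+\infty$. Growth condition $G(\Phi)$: for every $[\lambda_0,\lambda_1]\subseteq(0,+\infty)$ there exist $\alpha>0,\beta>0$ such that $\Phi^+(\lambda y)\le\alpha\Phi^+(y)+\beta(y+1)$ for all $y>0$ and all $\lambda\in[\lambda_0,\lambda_1]$, where $\Phi^+=\max(\Phi,0)$. *)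

(* Defs.v *)
(* MathComp-Analysis. *)
From HB Require Import structures.
From mathcomp Require Import all_boot all_order all_algebra.
From mathcomp Require Import all_classical all_reals all_analysis.

Set Implicit Arguments.
Unset Strict Implicit.
Unset Printing Implicit Defensive.

Import Order.TTheory GRing.Theory Num.Theory.
Import numFieldNormedType.Exports.
Local Open Scope classical_set_scope.
Local Open Scope ring_scope.

(* Processes are functions of (t, w) with t : R; only t in [0, T] is ever
   used. Random variables are represented by everywhere finite measurable
   functions, and path properties (càdlàg, finite variation) are required for
   every w, which under the usual conditions is no restriction up to
   indistinguishability. *)

Section StochasticBasis.
Context {R : realType} {disp : measure_display} {Omega : measurableType disp}.
Variables (P : probability Omega R) (T : R) (F : R -> set (set Omega)).

Definition filtration : Prop :=
  (forall t, 0 <= t <= T ->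
     sigma_algebra [set: Omega] (F t) /\ F t `<=` measurable) /\
  (forall s t, 0 <= s -> s <= t -> t <= T -> F s `<=` F t).

Definition usual_conditions : Prop :=
  (forall t, 0 <= t < T -> \bigcap_(u in `]t, T]) F u `<=` F t) /\
  (forall N : set Omega, P.-negligible N -> F 0 N).

Definition measurable_wrt (G : set (set Omega)) (h : Omega -> R) : Prop :=
  preimage_set_system setT h measurable `<=` G.

Definition adapted (Z : R -> Omega -> R) : Prop :=
  forall t, 0 <= t <= T -> measurable_wrt (F t) (Z t).

Definition cadlag (Z : R -> Omega -> R) : Prop :=
  forall w,
    (forall t, 0 <= t < T -> Z s w @[s --> t^'+] --> Z t w) /\
    (forall t, 0 < t <= T -> cvg (Z s w @[s --> t^'-])).

Definition predictable_rect : set (set (R * Omega)) :=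
  [set C | (exists2 A, F 0 A & C = [set 0] `*` A) \/
           (exists s t A, [/\ 0 <= s, s <= t, t <= T, F s A &
                              C = `]s, t] `*` A])].

Definition predictable d (H : R -> Omega -> 'rV[R]_d) : Prop :=
  forall i, preimage_set_system (`[0, T] `*` setT)
              (fun p : R * Omega => H p.1 p.2 ord0 i) measurable
            `<=` <<s `[0, T] `*` setT, predictable_rect >>.

Definition martingale (M : R -> Omega -> R) : Prop :=
  [/\ adapted M,
      (forall t, 0 <= t <= T -> P.-integrable setT (EFin \o M t)) &
      (forall s t A, 0 <= s -> s <= t -> t <= T -> F s A ->
         (\int[P]_(w in A) (M t w)%:E = \int[P]_(w in A) (M s w)%:E)%E)].

(* A value of tau beyond T plays the role of +oo. *)
Definition stopping_time (tau : Omega -> R) : Prop :=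
  (forall w, 0 <= tau w) /\
  (forall t, 0 <= t <= T -> F t [set w | tau w <= t]).

(* The time interval being closed, a localizing sequence has to reach T. *)
Definition local_martingale (M : R -> Omega -> R) : Prop :=
  [/\ adapted M, cadlag M & exists tau : nat -> Omega -> R,
    [/\ (forall n, stopping_time (tau n)),
        (forall w n, tau n w <= tau n.+1 w),
        {ae P, forall w, exists n, T <= tau n w} &
        (forall n, martingale (fun t w => M (Num.min t (tau n w)) w))]].

Definition finite_variation (A : R -> Omega -> R) : Prop :=
  [/\ adapted A, cadlag A & forall w, bounded_variation 0 T (A ^~ w)].

Definition semimartingale d (X : R -> Omega -> 'rV[R]_d) : Prop :=
  forall i, measurable_wrt (F 0) (fun w => X 0 w ord0 i) /\
    exists M A, [/\ local_martingale M, finite_variation A,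
      (forall w, M 0 w = 0), (forall w, A 0 w = 0) &
      forall t w, 0 <= t <= T ->
        X t w ord0 i = X 0 w ord0 i + M t w + A t w].

(* The elementary integrand
     el_init 1_{0} + \sum_(k < el_size) el_h k 1_{]el_s k, el_t k]}. *)
Record elem := Elem {
  el_init : Omega -> R;
  el_size : nat;
  el_s : nat -> R;
  el_t : nat -> R;
  el_h : nat -> Omega -> R }.

Definition bounded_rv (h : Omega -> R) : Prop :=
  exists C, forall w, `|h w| <= C.

Definition elem_wf (J : elem) : Prop :=
  [/\ measurable_wrt (F 0) (el_init J), bounded_rv (el_init J) &
   forall k, (k < el_size J)%N ->
   [/\ 0 <= el_s J k, el_s J k <= el_t J k, el_t J k <= T,
      measurable_wrt (F (el_s J k)) (el_h J k) & bounded_rv (el_h J k)]].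

Definition elem_val (J : elem) (t : R) (w : Omega) : R :=
  (if t == 0 then el_init J w else 0) +
  \sum_(k < el_size J) (if el_s J k < t <= el_t J k then el_h J k w else 0).

(* The integral over ]0, t]. *)
Definition elem_int (J : elem) (Z : R -> Omega -> R) (t : R) (w : Omega) : R :=
  \sum_(k < el_size J)
     el_h J k w * (Z (Num.min t (el_t J k)) w - Z (Num.min t (el_s J k)) w).

Definition elem_vval d (J : 'I_d -> elem) : R -> Omega -> 'rV[R]_d :=
  fun t w => \row_i elem_val (J i) t w.

Definition elem_vint d (J : 'I_d -> elem) (X : R -> Omega -> 'rV[R]_d)
    : R -> Omega -> R :=
  fun t w => \sum_i elem_int (J i) (fun s v => X s v ord0 i) t w.

(* P (sup_(0 <= t <= T) |Z t| > eps) <= delta, with P read as outer measure. *)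
Definition sup_small (Z : R -> Omega -> R) (eps delta : R) : Prop :=
  exists2 A : set Omega, measurable A /\ (P A <= delta%:E)%E &
    forall w, ~ A w -> forall t, 0 <= t <= T -> `|Z t w| <= eps.

Definition ucp_cvg (Y : nat -> R -> Omega -> R) (Z : R -> Omega -> R) : Prop :=
  forall eps delta : R, 0 < eps -> 0 < delta ->
    \forall n \near \oo,
      sup_small (fun t w => Y n t w - Z t w) eps delta.

(* Convergence in Émery's semimartingale topology: ucp convergence of the
   integrals of J against Y n - Z, uniformly over |J| <= 1. The term at time 0
   counts here (el_init J * Z 0), so that initial values converge as well. *)
Definition emery_cvg (Y : nat -> R -> Omega -> R) (Z : R -> Omega -> R) : Prop :=
  forall eps delta : R, 0 < eps -> 0 < delta ->
    \forall n \near \oo, forall J : elem, elem_wf J ->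
      (forall t w, 0 <= t <= T -> `|elem_val J t w| <= 1) ->
      let D := fun t w => Y n t w - Z t w in
      sup_small (fun t w => el_init J w * D 0 w + elem_int J D t w) eps delta.

Definition pointwise_cvg d (Hn : nat -> R -> Omega -> 'rV[R]_d)
    (H : R -> Omega -> 'rV[R]_d) : Prop :=
  forall t w i, 0 <= t <= T -> Hn n t w ord0 i @[n --> \oo] --> H t w ord0 i.

(* The graph of H |-> \int H . dX on bounded predictable processes: by the
   Bichteler-Dellacherie and monotone class theorems this integral is the only
   extension (up to indistinguishability) of the elementary integral that is
   compatible with bounded pointwise convergence. *)
Inductive bounded_integral d (X : R -> Omega -> 'rV[R]_d) :
    (R -> Omega -> 'rV[R]_d) -> (R -> Omega -> R) -> Prop :=
| bounded_integral_elem (J : 'I_d -> elem) :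
    (forall i, elem_wf (J i)) ->
    bounded_integral X (elem_vval J) (elem_vint J X)
| bounded_integral_lim Hn Yn H Y (C : R) :
    (forall n, bounded_integral X (Hn n) (Yn n)) ->
    (forall n t w i, 0 <= t <= T -> `|Hn n t w ord0 i| <= C) ->
    pointwise_cvg Hn H ->
    adapted Y -> cadlag Y -> ucp_cvg Yn Y ->
    bounded_integral X H Y.

(* H is X-integrable and Y is (a càdlàg version of) its integral process:
   bounded predictable processes converge pointwise to H while their integrals
   converge to Y in the semimartingale topology. For a semimartingale X the
   choice of the sequence is immaterial: by Mémin's theorem any two sequences
   give indistinguishable limits, and if some sequence works, then so does
   H 1_{|H| <= n}. *)
Definition stochastic_integral d (X : R -> Omega -> 'rV[R]_d)
    (H : R -> Omega -> 'rV[R]_d) (Y : R -> Omega -> R) : Prop :=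
  [/\ predictable H, adapted Y, cadlag Y &
   exists Hn Yn, [/\ (forall n, bounded_integral X (Hn n) (Yn n)),
     pointwise_cvg Hn H & emery_cvg Yn Y]].

Definition admissible_integral d (X : R -> Omega -> 'rV[R]_d)
    (H : R -> Omega -> 'rV[R]_d) (Y : R -> Omega -> R) : Prop :=
  stochastic_integral X H Y /\
  exists c : R, forall t, 0 <= t <= T -> {ae P, forall w, - c <= Y t w}.

Definition L0 : set (Omega -> R) := [set g | measurable_fun setT g].

Definition K_set d (X : R -> Omega -> 'rV[R]_d) : set (Omega -> R) :=
  [set g | L0 g /\ exists H Y, admissible_integral X H Y /\
                     {ae P, forall w, g w = Y T w}].

Definition L1 (Q : probability Omega R) : set (Omega -> R) :=
  [set g | Q.-integrable setT (EFin \o g)].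

Definition L1plus (Q : probability Omega R) : set (Omega -> R) :=
  [set h | L1 Q h /\ {ae Q, forall w, 0 <= h w}].

Definition minus_L0plus (A : set (Omega -> R)) : set (Omega -> R) :=
  [set f | L0 f /\ exists2 g, A g & {ae P, forall w, f w <= g w}].

Definition minus_L1plus (Q : probability Omega R) (A : set (Omega -> R))
    : set (Omega -> R) :=
  [set g \- h | g in A & h in L1plus Q].

Definition closureL1 (Q : probability Omega R) (A : set (Omega -> R))
    : set (Omega -> R) :=
  [set f | L1 Q f /\ forall eps : R, 0 < eps ->
     exists2 a, A a & (Lnorm Q 1 (fun w => (f w - a w)%:E) < eps%:E)%E].

Definition equivalent_probabilities : set (probability Omega R) :=
  [set Q : probability Omega R | Q `<< P /\ P `<< Q].

Definition M1 (K : set (Omega -> R)) : set (probability Omega R) :=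
  [set Q : probability Omega R | [/\ Q `<< P, K `<=` L1 Q & forall g, K g -> ('E_Q[g] <= 0)%E]].

(* Phi, extended to 0 by its right limit there; the value at negative
   arguments is irrelevant. *)
Definition Phi_ext (Phi : R -> R) (y : R) : \bar R :=
  if 0 < y then (Phi y)%:E else lim ((Phi z)%:E @[z --> 0^'+]).

Definition density (Q : probability Omega R) (w : Omega) : R :=
  fine (Radon_Nikodym (charge_of_finite_measure Q) P w).

Definition M_Phi (Phi : R -> R) (K : set (Omega -> R))
    : set (probability Omega R) :=
  [set Q : probability Omega R | M1 K Q /\ P.-integrable setT (fun w => Phi_ext Phi (density Q w))].

Definition growth_condition (Phi : R -> R) : Prop :=
  forall l0 l1 : R, 0 < l0 -> l0 <= l1 ->
    exists alpha beta : R, [/\ 0 < alpha, 0 < beta &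
      forall y l, 0 < y -> l0 <= l <= l1 ->
        Num.max (Phi (l * y)) 0 <= alpha * Num.max (Phi y) 0 + beta * (y + 1)].

Definition f_hat_Phi (Phi : R -> R) (K : set (Omega -> R)) (f : Omega -> R)
    : \bar R :=
  ereal_inf [set x%:E | x in [set x : R | forall Q, M_Phi Phi K Q ->
    closureL1 Q (minus_L1plus Q K) (fun w => f w - x)]].

Definition f_hat (K : set (Omega -> R)) (f : Omega -> R) : \bar R :=
  ereal_inf [set x%:E | x in [set x : R |
    minus_L0plus K (fun w => f w - x)]].

End StochasticBasis.

(* Main.v *)
Require Import Defs.
From HB Require Import structures.
From mathcomp Require Import all_boot all_order all_algebra.
From mathcomp Require Import all_classical all_reals all_analysis.
From mathcomp Require Import measurable_realfun lra.

(** Write [K] for the set of terminal values of admissible integrals.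

    If [f - x] lies in the $L^1(Q)$-closure of $K - L^1_+(Q)$, then integrating
    against [Q] gives $E_Q[f] \le x$, because every element of [K] has nonpositive
    expectation; the same computation with $f - x \le g \in K$ gives the bound by
    the superhedging price [f_hat] ([closureL1_expectation_le0],
    [ae_le_Rint]). What has to be proved is the converse: if [f - x] is not in the
    closure for some [Q] in [M_Phi], then some [Q'] in [M_Phi] satisfies
    $E_{Q'}[f] > x$ ([M_Phi_separation]).

    The set [K] is a convex cone ([K_set0], [K_setD], [K_setZ]), since the
    stochastic integral is linear in the integrand. Hence the distance
    $p(u) = \inf_{g \in K} E_Q[(u - g)^+]$ from [u] to $K - L^1_+(Q)$ is
    sublinear, and it is positive at $u = f - x$. The Hahn-Banach theorem
    ([hahn_banach]) gives a linear $\varphi \le p$ on $L^1(Q)$ with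
    $\varphi(f - x) > 0$. From $\varphi \le p$ one reads off $\varphi \le 0$ on [K]
    and $0 \le \varphi(v) \le E_Q[v]$ for $v \ge 0$ ([separating_functional]).

    The functional $\varphi$ alone might give a measure whose density relative
    to [Q] comes close to [0], where the growth condition says nothing. So one takes
    $\psi = (\varphi + e E_Q) / (\varphi(1) + e)$ with $e > 0$ so small that
    $\psi(f - x) > 0$. As a positive functional dominated by a multiple of $E_Q$,
    $\psi$ is the expectation under a probability [Q']
    ([functional_representation]), and $a Q \le Q' \le b Q$ with $0 < a \le b$
    ([separating_measure]). The densities of [Q] and [Q'] with respect to [P] are
    comparable in the same way, so their quotient stays in $[a, b]$ where the
    density of [Q] is positive. There the growth condition controls
    $\Phi^+(dQ'/dP)$ and an affine minorant of [Phi] controls the negative part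
    ([Phi_ext_integrable_comparable]). Hence [Q'] belongs to [M_Phi]. *)

Set Implicit Arguments.
Unset Strict Implicit.
Unset Printing Implicit Defensive.

Import Order.TTheory GRing.Theory Num.Theory.
Import numFieldNormedType.Exports.
Import HBSimple.
Local Open Scope classical_set_scope.
Local Open Scope ring_scope.

(** * Measurability relative to a sub-sigma-algebra *)

Section relative_measurability.
Context {R : realType} (U : pointedType) (D : set U) (S : set (set U)).
Hypothesis sS : sigma_algebra D S.

Let trace_sigma_algebra A : <<s S >> A -> S (D `&` A).
Proof.
case: sS => S0 SC SU SA.
apply: (SA [set B | S (D `&` B)]); split; first split => /=.
- by rewrite setI0.
- move=> B SB; rewrite setTD (_ : D `&` ~` B = D `\` (D `&` B)); first exact: SC.
  by rewrite setDIr setDv set0U setDE.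
- by move=> B SB; rewrite setI_bigcupr; exact: SU.
- move=> B SB /=; rewrite (_ : D `&` B = D `\` (D `\` B)); first exact/SC/SC.
  by rewrite setDD.
Qed.

(** Measurability relative to a $\sigma$-algebra [S] carried by the part [D] is
    ordinary measurability on [D] for the $\sigma$-algebra that [S] generates on
    the whole type, so the library applies to it. *)
Let relative_measurableP (f : U -> R) :
  preimage_set_system D f measurable `<=` S <->
  measurable_fun (D : set (g_sigma_algebraType S)) (f : g_sigma_algebraType S -> R).
Proof.
split=> [fS _ B mB|mf _ [B mB <-]].
  by apply: sub_sigma_algebra; apply: fS; exists B.
have mD : measurable (D : set (g_sigma_algebraType S)).
  by apply: sub_sigma_algebra; case: sS => S0 SC _; rewrite -(setD0 D); exact: SC.
by have := mf mD B mB => /trace_sigma_algebra; rewrite setIA setIid.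
Qed.

Lemma relative_measurableD (f g : U -> R) :
  preimage_set_system D f measurable `<=` S ->
  preimage_set_system D g measurable `<=` S ->
  preimage_set_system D (fun u => f u + g u) measurable `<=` S.
Proof.
by move=> /relative_measurableP mf /relative_measurableP mg;
  apply/relative_measurableP; exact: measurable_funD.
Qed.

Lemma relative_measurableM (f g : U -> R) :
  preimage_set_system D f measurable `<=` S ->
  preimage_set_system D g measurable `<=` S ->
  preimage_set_system D (fun u => f u * g u) measurable `<=` S.
Proof.
by move=> /relative_measurableP mf /relative_measurableP mg;
  apply/relative_measurableP; exact: measurable_funM.
Qed.

Lemma relative_measurable_cst (c : R) :
  preimage_set_system D (fun=> c) measurable `<=` S.
Proof. by apply/relative_measurableP; exact: measurable_cst. Qed.

End relative_measurability.

(** * Adapted and càdlàg processes *)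

Section processes.
Context {R : realType} {disp : measure_display} {Omega : measurableType disp}.
Variables (T : R) (F : R -> set (set Omega)).
Hypothesis F_filtration : filtration T F.

Lemma filtration_sub s t : 0 <= s -> s <= t -> t <= T -> F s `<=` F t.
Proof. by case: F_filtration => _; exact. Qed.

Lemma filtration_sigma t : 0 <= t <= T -> sigma_algebra setT (F t).
Proof. by case: F_filtration => + _ => /[apply] -[]. Qed.

Lemma measurable_wrtD G (f g : Omega -> R) : sigma_algebra setT G ->
  measurable_wrt G f -> measurable_wrt G g ->
  measurable_wrt G (fun w => f w + g w).
Proof. by move=> sG mf mg; exact: (relative_measurableD sG mf mg). Qed.

Lemma measurable_wrtM G (f g : Omega -> R) : sigma_algebra setT G ->
  measurable_wrt G f -> measurable_wrt G g ->
  measurable_wrt G (fun w => f w * g w).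
Proof. by move=> sG mf mg; exact: (relative_measurableM sG mf mg). Qed.

Lemma measurable_wrt_cst G (c : R) : sigma_algebra setT G ->
  measurable_wrt G (fun _ : Omega => c).
Proof. by move=> sG; exact: (relative_measurable_cst sG). Qed.

Lemma measurable_wrtS G G' (f : Omega -> R) : G `<=` G' ->
  measurable_wrt G f -> measurable_wrt G' f.
Proof. by move=> GG' /subset_trans; exact. Qed.

Lemma adaptedD Y Z : adapted T F Y -> adapted T F Z ->
  adapted T F (fun t w => Y t w + Z t w).
Proof.
move=> aY aZ t t0T.
by apply: measurable_wrtD; [exact: filtration_sigma|exact: aY|exact: aZ].
Qed.

Lemma adaptedZ (c : R) Y : adapted T F Y -> adapted T F (fun t w => c * Y t w).
Proof.
move=> aY t t0T; have sF := filtration_sigma t0T.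
by apply: measurable_wrtM => //; [exact: measurable_wrt_cst|exact: aY].
Qed.

Lemma adapted0 : adapted T F (fun _ _ => 0).
Proof. by move=> t t0T; exact: (measurable_wrt_cst (filtration_sigma t0T)). Qed.

Lemma cadlag0 : cadlag T (fun _ (_ : Omega) => 0 : R).
Proof. by move=> w; split => t _; [exact: cvg_cst|exact: is_cvg_cst]. Qed.

Lemma cadlagD (Y Z : R -> Omega -> R) : cadlag T Y -> cadlag T Z ->
  cadlag T (fun t w => Y t w + Z t w).
Proof.
move=> cY cZ w; have [rY lY] := cY w; have [rZ lZ] := cZ w; split => t tT.
  by apply: cvgD; [exact: rY|exact: rZ].
by apply: is_cvgD; [exact: lY|exact: lZ].
Qed.

Lemma cadlagM (h : Omega -> R) (Y : R -> Omega -> R) : cadlag T Y ->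
  cadlag T (fun t w => h w * Y t w).
Proof.
move=> cY w; have [rY lY] := cY w; split => t tT.
  by apply: cvgM; [exact: cvg_cst|exact: rY].
by apply: is_cvgM; [exact: is_cvg_cst|exact: lY].
Qed.

Lemma cadlag_stopped (a : R) (Y : R -> Omega -> R) : cadlag T Y ->
  cadlag T (fun t w => Y (Num.min t a) w).
Proof.
move=> cY w; have [rY lY] := cY w; split => t /andP[t0 tT].
  have [ta|at_] := ltP t a.
    apply: (@cvg_trans _ (Y s w @[s --> t^'+])); last by apply: rY; rewrite t0.
    apply: near_eq_cvg; near=> s; rewrite min_l//.
    by near: s; exact: nbhs_right_le.
  apply: (@cvg_trans _ (Y a w @[_ --> t^'+])); last exact: cvg_cst.
  by apply: near_eq_cvg; near=> s; rewrite min_r// (le_trans at_).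
have [ta|at_] := leP t a.
  have tT' : 0 < t <= T by rewrite t0.
  apply: (cvgP _ (cvg_trans _ (lY t tT'))).
  apply: near_eq_cvg; near=> s; by rewrite min_l// (le_trans _ ta).
apply: (cvgP (Y a w)); apply: (@cvg_trans _ (Y a w @[_ --> t^'-])).
  apply: near_eq_cvg; near=> s; rewrite min_r//.
  by near: s; exact: nbhs_left_ge.
exact: cvg_cst.
Unshelve. all: by end_near. Qed.

Lemma process_sum (C : (R -> Omega -> R) -> Prop) :
  C (fun _ _ => 0) ->
  (forall Y Z, C Y -> C Z -> C (fun t w => Y t w + Z t w)) ->
  forall n (Y : 'I_n -> R -> Omega -> R), (forall i, C (Y i)) ->
  C (fun t w => \sum_(i < n) Y i t w).
Proof.
move=> C0 CD; elim=> [|n IHn] Y CY.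
  rewrite (_ : (fun _ => _) = fun _ _ => 0)//.
  by apply/funext => t; apply/funext => w; rewrite big_ord0.
rewrite (_ : (fun _ => _) = fun t w =>
    \sum_(i < n) Y (widen_ord (leqnSn n) i) t w + Y ord_max t w).
  by apply: CD => //; exact: IHn.
by apply/funext => t; apply/funext => w; rewrite big_ord_recr.
Qed.

End processes.

(** * Elementary integrands *)

Section elementary_integrands.
Context {R : realType} {disp : measure_display} {Omega : measurableType disp}.
Variables (T : R) (F : R -> set (set Omega)).
Hypothesis F_filtration : filtration T F.
Implicit Types J : elem (R := R) (Omega := Omega).

Definition elem_add J J' : elem := Elem
  (fun w => el_init J w + el_init J' w)
  (el_size J + el_size J')
  (fun k => if (k < el_size J)%N then el_s J k else el_s J' (k - el_size J))
  (fun k => if (k < el_size J)%N then el_t J k else el_t J' (k - el_size J))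
  (fun k => if (k < el_size J)%N then el_h J k else el_h J' (k - el_size J)).

Definition elem_scale (c : R) J : elem := Elem
  (fun w => c * el_init J w) (el_size J) (el_s J) (el_t J)
  (fun k w => c * el_h J k w).

Definition elem_zero : elem := @Elem R disp Omega
  (fun=> 0) 0 (fun=> 0) (fun=> 0) (fun=> cst 0).

Lemma bounded_rvD (g h : Omega -> R) : bounded_rv g -> bounded_rv h ->
  bounded_rv (fun w => g w + h w).
Proof.
move=> [a ga] [b hb]; exists (a + b) => w.
by rewrite (le_trans (ler_normD _ _))// lerD.
Qed.

Lemma bounded_rvZ (c : R) (h : Omega -> R) : bounded_rv h ->
  bounded_rv (fun w => c * h w).
Proof. by move=> [a ha]; exists (`|c| * a) => w; rewrite normrM ler_wpM2l. Qed.

Lemma elem_wf_add J J' : 0 <= T -> elem_wf T F J -> elem_wf T F J' ->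
  elem_wf T F (elem_add J J').
Proof.
move=> T0 [mJ bJ kJ] [mJ' bJ' kJ']; split => [||k /= kn].
- by apply: measurable_wrtD => //; apply: (filtration_sigma F_filtration); rewrite lexx.
- exact: bounded_rvD.
- case: ifPn => [/kJ//|]; rewrite -leqNgt => nk; apply: kJ'.
  by rewrite ltn_subLR.
Qed.

Lemma elem_wf_scale c J : 0 <= T -> elem_wf T F J -> elem_wf T F (elem_scale c J).
Proof.
move=> T0 [mJ bJ kJ]; split => [||k /= /kJ [s0 st tT mh bh]].
- have sF : sigma_algebra setT (F 0).
    by apply: (filtration_sigma F_filtration); rewrite lexx.
  by apply: measurable_wrtM => //; exact: measurable_wrt_cst.
- exact: bounded_rvZ.
- split => //; last exact: bounded_rvZ.
  have sF : sigma_algebra setT (F (el_s J k)).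
    by apply: (filtration_sigma F_filtration); rewrite s0 (le_trans st).
  by apply: measurable_wrtM => //; exact: measurable_wrt_cst.
Qed.

Lemma elem_wf_zero : 0 <= T -> elem_wf T F elem_zero.
Proof.
move=> T0; split => //; last by exists 0 => w; rewrite normr0.
by apply: measurable_wrt_cst; apply: (filtration_sigma F_filtration); rewrite lexx.
Qed.

Lemma elem_val_add J J' t w :
  elem_val (elem_add J J') t w = elem_val J t w + elem_val J' t w.
Proof.
rewrite /elem_val /= big_split_ord /= [RHS]addrACA; congr (_ + (_ + _)).
- by case: ifP; rewrite ?addr0.
- by apply: eq_bigr => i _; rewrite ltn_ord.
- by apply: eq_bigr => i _; rewrite ltnNge leq_addr /= addKn.
Qed.

Lemma elem_int_add J J' Z t w :
  elem_int (elem_add J J') Z t w = elem_int J Z t w + elem_int J' Z t w.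
Proof.
rewrite /elem_int /= big_split_ord /=; congr (_ + _).
- by apply: eq_bigr => i _; rewrite ltn_ord.
- by apply: eq_bigr => i _; rewrite ltnNge leq_addr /= addKn.
Qed.

Lemma elem_val_scale c J t w :
  elem_val (elem_scale c J) t w = c * elem_val J t w.
Proof.
rewrite /elem_val /= mulrDr mulr_sumr; congr (_ + _).
  by case: ifP; rewrite ?mulr0.
by apply: eq_bigr => i _; case: ifP; rewrite ?mulr0.
Qed.

Lemma elem_int_scale c J Z t w :
  elem_int (elem_scale c J) Z t w = c * elem_int J Z t w.
Proof.
by rewrite /elem_int /= mulr_sumr; apply: eq_bigr => i _; rewrite mulrA.
Qed.

Lemma elem_val_bounded J : elem_wf T F J ->
  exists C, forall t w, `|elem_val J t w| <= C.
Proof.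
move=> [_ [C0 JC0] kJ].
have [D JD] : exists D, forall t w, `|\sum_(k < el_size J)
    (if el_s J k < t <= el_t J k then el_h J k w else 0)| <= D.
  pose B (Y : R -> Omega -> R) := exists D, forall t w, `|Y t w| <= D.
  apply: (@process_sum _ _ _ B _ _ _
    (fun k t w => if el_s J k < t <= el_t J k then el_h J k w else 0)).
  - by exists 0 => t w; rewrite normr0.
  - move=> Y Z [a Ya] [b Zb]; exists (a + b) => t w.
    by rewrite (le_trans (ler_normD _ _))// lerD.
  - move=> k; have [_ _ _ _ [a ha]] := kJ k (ltn_ord k); exists a => t w.
    by case: ifP => // _; rewrite normr0 (le_trans _ (ha w)).
exists (C0 + D) => t w; rewrite (le_trans (ler_normD _ _))// lerD//.
by case: ifP => // _; rewrite normr0 (le_trans _ (JC0 w)).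
Qed.

Lemma elem_int_cadlag J Z : cadlag T Z -> cadlag T (elem_int J Z).
Proof.
move=> cZ; apply: (@process_sum _ _ _ (cadlag T) _ _ _ (fun k t w => el_h J k w *
  (Z (Num.min t (el_t J k)) w - Z (Num.min t (el_s J k)) w))).
- exact: cadlag0.
- exact: cadlagD.
- move=> k; apply: cadlagM; apply: cadlagD; first exact: cadlag_stopped.
  rewrite (_ : (fun _ => _) = fun t w => cst (-1) w * Z (Num.min t (el_s J k)) w).
    by apply: cadlagM; exact: cadlag_stopped.
  by apply/funext => t; apply/funext => w; rewrite mulN1r.
Qed.

(** Before the start of a block its increment vanishes, afterwards its weight is
    already known. *)
Lemma elem_int_adapted J Z : elem_wf T F J -> adapted T F Z ->
  adapted T F (elem_int J Z).
Proof.
move=> [_ _ kJ] aZ.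
apply: (@process_sum _ _ _ (adapted T F) _ _ _ (fun k t w => el_h J k w *
  (Z (Num.min t (el_t J k)) w - Z (Num.min t (el_s J k)) w))).
- exact: adapted0.
- exact: adaptedD.
- move=> k t /andP[t0 tT]; have [s0 st uT mh _] := kJ k (ltn_ord k).
  have sF : sigma_algebra setT (F t).
    by apply: (filtration_sigma F_filtration); rewrite t0.
  have [ts|st'] := leP t (el_s J k).
    rewrite (_ : (fun _ => _) = fun=> 0); first exact: measurable_wrt_cst.
    by apply/funext => w; rewrite (min_l (le_trans ts st)) subrr mulr0.
  have mZ u : 0 <= u -> measurable_wrt (F t) (Z (Num.min t u)).
    move=> u0; have m0 : 0 <= Num.min t u by rewrite le_min t0.
    have mt : Num.min t u <= t by rewrite ge_min lexx.
    apply: (measurable_wrtS (filtration_sub F_filtration m0 mt tT)).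
    by apply: aZ; rewrite m0 (le_trans mt).
  apply: measurable_wrtM => //.
    apply: measurable_wrtS mh; exact: (filtration_sub F_filtration s0 (ltW st') tT).
  apply: measurable_wrtD => //; first by apply: mZ; rewrite (le_trans s0).
  rewrite [X in measurable_wrt _ X](_ : _ = fun w => -1 * Z (Num.min t (el_s J k)) w).
    by apply: (measurable_wrtM sF (measurable_wrt_cst sF) (mZ _ s0)).
  by apply/funext => w; rewrite mulN1r min_r// ltW.
Qed.

End elementary_integrands.

(** * Linearity of the stochastic integral *)

Section bounded_integrals.
Context {R : realType} {disp : measure_display} {Omega : measurableType disp}.
Variables (P : probability Omega R) (T : R) (F : R -> set (set Omega)).
Hypotheses (T_ge0 : 0 <= T) (F_filtration : filtration T F).
Variables (d : nat) (X : R -> Omega -> 'rV[R]_d).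
Hypothesis X_cadlag : forall i, cadlag T (fun t w => X t w ord0 i).
Hypothesis X_adapted : forall i, adapted T F (fun t w => X t w ord0 i).
Implicit Types (J : 'I_d -> elem (R := R) (Omega := Omega)).

Lemma elem_vval_add J J' : elem_vval (fun i => elem_add (J i) (J' i)) =
  (fun t w => elem_vval J t w + elem_vval J' t w).
Proof.
apply/funext => t; apply/funext => w; apply/rowP => i.
by rewrite !mxE elem_val_add.
Qed.

Lemma elem_vint_add J J' : elem_vint (fun i => elem_add (J i) (J' i)) X =
  (fun t w => elem_vint J X t w + elem_vint J' X t w).
Proof.
apply/funext => t; apply/funext => w; rewrite /elem_vint -big_split /=.
by apply: eq_bigr => i _; rewrite elem_int_add.
Qed.

Lemma elem_vval_scale c J : elem_vval (fun i => elem_scale c (J i)) =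
  (fun t w => c *: elem_vval J t w).
Proof.
apply/funext => t; apply/funext => w; apply/rowP => i.
by rewrite !mxE elem_val_scale.
Qed.

Lemma elem_vint_scale c J : elem_vint (fun i => elem_scale c (J i)) X =
  (fun t w => c * elem_vint J X t w).
Proof.
apply/funext => t; apply/funext => w; rewrite /elem_vint mulr_sumr /=.
by apply: eq_bigr => i _; rewrite elem_int_scale.
Qed.

(** These are the side conditions under which the graph of the integral is closed
    under limits; they are needed again to translate a convergent sequence. *)
Lemma bounded_integral_regular H Y : bounded_integral P T F X H Y ->
  [/\ adapted T F Y, cadlag T Y &
      exists C, forall t w i, 0 <= t <= T -> `|H t w ord0 i| <= C].
Proof.
elim=> {H Y} [J wfJ|Hn Yn H Y C _ _ HnC HnH aY cY _]; split => //.
- apply: (@process_sum _ _ _ (adapted T F) _ _ _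
    (fun i => elem_int (J i) (fun s v => X s v ord0 i))).
  + exact: adapted0.
  + exact: adaptedD.
  + by move=> i; exact: elem_int_adapted.
- apply: (@process_sum _ _ _ (cadlag T) _ _ _
    (fun i => elem_int (J i) (fun s v => X s v ord0 i))).
  + exact: cadlag0.
  + exact: cadlagD.
  + by move=> i; exact: elem_int_cadlag.
- have /choice[C JC] i := elem_val_bounded (wfJ i).
  exists (\sum_i `|C i|) => t w i _; rewrite mxE (le_trans (JC i t w))//.
  rewrite (bigD1 i)//= (le_trans (ler_norm _))// lerDl.
  by apply: sumr_ge0 => j _.
- exists C => t w i tT; apply: (cvgr_to_le (cvg_norm (HnH t w i tT))).
  by near=> n; exact: HnC.
Unshelve. all: by end_near. Qed.

Lemma ucp_cvgDr Yn Y Z : ucp_cvg P T Yn Y ->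
  ucp_cvg P T (fun n t w => Yn n t w + Z t w) (fun t w => Y t w + Z t w).
Proof.
move=> YnY eps delta eps0 delta0; apply: filterS (YnY _ _ eps0 delta0) => n.
move=> [A mPA AY]; exists A => // w Aw t tT.
by rewrite opprD addrACA subrr addr0; exact: AY.
Qed.

Lemma sup_smallD (Y Z : R -> Omega -> R) eps eps' delta delta' :
  sup_small P T Y eps delta -> sup_small P T Z eps' delta' ->
  sup_small P T (fun t w => Y t w + Z t w) (eps + eps') (delta + delta').
Proof.
move=> [A [mA PA] AY] [B [mB PB] BZ]; exists (A `|` B).
  split; first exact: measurableU.
  by rewrite (le_trans (measureU2 _ mA mB))// EFinD leeD.
move=> w /not_orP[Aw Bw] t tT.
by rewrite (le_trans (ler_normD _ _))// lerD// ?AY ?BZ.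
Qed.

Lemma sup_smallZ c (Y : R -> Omega -> R) eps delta : 0 <= eps ->
  sup_small P T Y (eps / (`|c| + 1)) delta ->
  sup_small P T (fun t w => c * Y t w) eps delta.
Proof.
move=> eps0 [A mPA AY]; exists A => // w Aw t tT; rewrite normrM.
have c1 : 0 < `|c| + 1 by rewrite ltr_wpDl.
rewrite (le_trans (ler_wpM2l (normr_ge0 c) (AY w Aw t tT)))// mulrCA ler_piMr//.
by rewrite ler_pdivrMr// mul1r lerDl.
Qed.

Let scale_gt0 (c eps : R) : 0 < eps -> 0 < eps / (`|c| + 1).
Proof. by move=> eps0; rewrite divr_gt0// ltr_wpDl. Qed.

Lemma ucp_cvgZ c Yn Y : ucp_cvg P T Yn Y ->
  ucp_cvg P T (fun n t w => c * Yn n t w) (fun t w => c * Y t w).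
Proof.
move=> YnY eps delta eps0 delta0.
apply: filterS (YnY _ _ (scale_gt0 c eps0) delta0) => n.
move=> /(sup_smallZ (ltW eps0)) [A mPA AY]; exists A => // w Aw t tT.
by rewrite -mulrBr; exact: AY.
Qed.

(** Adding a fixed integrand keeps an approximating sequence uniformly bounded,
    so the graph of the integral is closed under addition of elementary
    integrands first, and then, by induction on the other argument, under
    addition of bounded ones. *)
Lemma bounded_integralD H Y H' Y' :
  bounded_integral P T F X H Y -> bounded_integral P T F X H' Y' ->
  bounded_integral P T F X (fun t w => H t w + H' t w)
    (fun t w => Y t w + Y' t w).
Proof.
have lim_step G Z Hn Yn K V C : bounded_integral P T F X G Z ->
    (forall n, bounded_integral P T F X (fun t w => Hn n t w + G t w)
      (fun t w => Yn n t w + Z t w)) ->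
    (forall n t w i, 0 <= t <= T -> `|Hn n t w ord0 i| <= C) ->
    pointwise_cvg T Hn K -> adapted T F V -> cadlag T V -> ucp_cvg P T Yn V ->
    bounded_integral P T F X (fun t w => K t w + G t w)
      (fun t w => V t w + Z t w).
  move=> /bounded_integral_regular[aZ cZ [D GD]] sHn HnC HnK aV cV YnV.
  apply: (bounded_integral_lim (C := C + D) sHn).
  - move=> n t w i tT; rewrite mxE (le_trans (ler_normD _ _))// lerD//.
      exact: HnC.
    exact: GD.
  - move=> t w i tT; under eq_fun do rewrite mxE.
    by rewrite mxE; apply: cvgD; [exact: HnK|exact: cvg_cst].
  - exact: adaptedD.
  - exact: cadlagD.
  - exact: ucp_cvgDr.
have addC (V W : R -> Omega -> 'rV[R]_d) :
    (fun t w => V t w + W t w) = (fun t w => W t w + V t w).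
  by apply/funext => t; apply/funext => w; rewrite addrC.
have addCr (V W : R -> Omega -> R) :
    (fun t w => V t w + W t w) = (fun t w => W t w + V t w).
  by apply/funext => t; apply/funext => w; rewrite addrC.
elim=> {H Y} [J wfJ|Hn Yn H Y C _ IH HnC HnH aY cY YnY] iH'; last first.
  by apply: (lim_step _ _ Hn Yn _ _ C) => // n; exact: IH.
elim: iH' => {H' Y'} [J' wfJ'|Hn Yn H Y C _ IH HnC HnH aY cY YnY].
  rewrite -elem_vval_add -elem_vint_add; apply: bounded_integral_elem => i.
  exact: elem_wf_add.
rewrite addC addCr; apply: (lim_step _ _ Hn Yn _ _ C) => //.
  exact: bounded_integral_elem.
by move=> n; rewrite addC addCr; exact: IH.
Qed.

Lemma bounded_integralZ c H Y : bounded_integral P T F X H Y ->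
  bounded_integral P T F X (fun t w => c *: H t w) (fun t w => c * Y t w).
Proof.
elim=> {H Y} [J wfJ|Hn Yn H Y C _ IH HnC HnH aY cY YnY].
  rewrite -elem_vval_scale -elem_vint_scale; apply: bounded_integral_elem => i.
  exact: elem_wf_scale.
apply: (bounded_integral_lim (C := `|c| * C) IH).
- by move=> n t w i tT; rewrite mxE normrM ler_wpM2l// HnC.
- move=> t w i tT; under eq_fun do rewrite mxE.
  by rewrite mxE; apply: cvgM; [exact: cvg_cst|exact: HnH].
- exact: adaptedZ.
- exact: (cadlagM (fun=> c)).
- exact: ucp_cvgZ.
Qed.

Lemma elem_intDr (J : elem (R := R) (Omega := Omega)) Y Z t w :
  elem_int J (fun s v => Y s v + Z s v) t w = elem_int J Y t w + elem_int J Z t w.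
Proof.
rewrite /elem_int -big_split; apply: eq_bigr => k _ /=.
by rewrite opprD addrACA mulrDr.
Qed.

Lemma elem_intZr (J : elem (R := R) (Omega := Omega)) c Y t w :
  elem_int J (fun s v => c * Y s v) t w = c * elem_int J Y t w.
Proof.
rewrite /elem_int mulr_sumr; apply: eq_bigr => k _.
by rewrite -mulrBr mulrCA.
Qed.

Lemma emery_cvgD Yn Y Zn Z : emery_cvg P T F Yn Y -> emery_cvg P T F Zn Z ->
  emery_cvg P T F (fun n t w => Yn n t w + Zn n t w) (fun t w => Y t w + Z t w).
Proof.
move=> YnY ZnZ eps delta eps0 delta0.
have [e2 d2] : 0 < eps / 2 /\ 0 < delta / 2 by rewrite !divr_gt0.
near=> n => J wfJ J1 /=.
have sY : sup_small P T (fun t w => el_init J w * (Yn n 0 w - Y 0 w) +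
    elem_int J (fun t w => Yn n t w - Y t w) t w) (eps / 2) (delta / 2).
  by move: J wfJ J1; near: n; exact: YnY.
have sZ : sup_small P T (fun t w => el_init J w * (Zn n 0 w - Z 0 w) +
    elem_int J (fun t w => Zn n t w - Z t w) t w) (eps / 2) (delta / 2).
  by move: J wfJ J1 sY; near: n; apply: filterS (ZnZ _ _ e2 d2) => n + J wfJ J1 _; exact.
have := sup_smallD sY sZ; rewrite -!splitr.
congr (sup_small _ _ _ _ _); apply/funext => t; apply/funext => w.
rewrite addrACA -mulrDr -elem_intDr; congr (_ + _).
  by rewrite opprD addrACA.
congr (elem_int J _ t w).
by apply/funext => s; apply/funext => v; rewrite opprD addrACA.
Unshelve. all: by end_near. Qed.

Lemma emery_cvgZ c Yn Y : emery_cvg P T F Yn Y ->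
  emery_cvg P T F (fun n t w => c * Yn n t w) (fun t w => c * Y t w).
Proof.
move=> YnY eps delta eps0 delta0.
apply: filterS (YnY _ _ (scale_gt0 c eps0) delta0) => n + J wfJ J1 => /(_ J wfJ J1).
move=> /(sup_smallZ (ltW eps0)).
congr (sup_small _ _ _ _ _); apply/funext => t; apply/funext => w.
rewrite mulrDr -elem_intZr mulrCA mulrBr; congr (_ + _).
congr (elem_int J _ t w).
by apply/funext => s; apply/funext => v; rewrite mulrBr.
Qed.

End bounded_integrals.

(** * The convex cone of terminal values *)

Section attainable_claims.
Context {R : realType} {disp : measure_display} {Omega : measurableType disp}.
Variables (P : probability Omega R) (T : R) (F : R -> set (set Omega)).
Hypotheses (T_ge0 : 0 <= T) (F_filtration : filtration T F).
Variables (d : nat) (X : R -> Omega -> 'rV[R]_d).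
Hypothesis X_cadlag : forall i, cadlag T (fun t w => X t w ord0 i).
Hypothesis X_semimartingale : semimartingale P T F X.
Local Notation K := (K_set P T F X).

Lemma semimartingale_adapted i : adapted T F (fun t w => X t w ord0 i).
Proof.
move=> t /andP[t0 tT]; have [mX0 [M [A [[aM _ _] [aA _ _] _ _ XMA]]]] :=
  X_semimartingale i.
rewrite (_ : (fun _ => _) = fun w => (X 0 w ord0 i + M t w) + A t w); last first.
  by apply/funext => w; rewrite XMA// t0.
have sF : sigma_algebra setT (F t).
  by apply: (filtration_sigma F_filtration); rewrite t0.
apply: measurable_wrtD => //; last by apply: aA; rewrite t0.
apply: measurable_wrtD => //; last by apply: aM; rewrite t0.
apply: measurable_wrtS mX0; exact: (filtration_sub F_filtration (lexx 0) t0 tT).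
Qed.
Let X_adapted := semimartingale_adapted.

Lemma predictableD (H H' : R -> Omega -> 'rV[R]_d) :
  predictable T F H -> predictable T F H' ->
  predictable T F (fun t w => H t w + H' t w).
Proof.
move=> pH pH' i.
rewrite (_ : (fun _ => _) = fun p : R * Omega =>
  H p.1 p.2 ord0 i + H' p.1 p.2 ord0 i); last by apply/funext => p; rewrite mxE.
exact: (relative_measurableD (smallest_sigma_algebra _ _) (pH i) (pH' i)).
Qed.

Lemma predictableZ c (H : R -> Omega -> 'rV[R]_d) :
  predictable T F H -> predictable T F (fun t w => c *: H t w).
Proof.
move=> pH i; rewrite (_ : (fun _ => _) = fun p : R * Omega =>
  c * H p.1 p.2 ord0 i); last by apply/funext => p; rewrite mxE.
have sS := smallest_sigma_algebra (`[0, T] `*` setT) (predictable_rect T F).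
exact: (relative_measurableM sS (relative_measurable_cst (c := c) sS) (pH i)).
Qed.

Lemma predictable0 : predictable T F (fun _ _ => 0 : 'rV[R]_d).
Proof.
move=> i; rewrite (_ : (fun _ => _) = fun p : R * Omega => 0); last first.
  by apply/funext => p; rewrite mxE.
exact: (relative_measurable_cst (smallest_sigma_algebra _ _)).
Qed.

Lemma K_set0 : K (fun=> 0).
Proof.
split; first exact: measurable_cst.
pose J (i : 'I_d) : elem := elem_zero (R := R) (Omega := Omega).
have J0 : elem_vval J = fun _ _ => 0.
  apply/funext => t; apply/funext => w; apply/rowP => i.
  by rewrite !mxE /elem_val /= big_ord0 addr0; case: ifP.
have I0 : elem_vint J X = fun _ _ => 0.
  apply/funext => t; apply/funext => w; rewrite /elem_vint big1// => i _.
  by rewrite /elem_int big_ord0.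
exists (fun _ _ => 0), (fun _ _ => 0); split; last by apply: aeW.
split; last by exists 0 => t _; apply: aeW => w; rewrite oppr0.
split; [exact: predictable0|exact: adapted0|exact: cadlag0|].
exists (fun _ _ _ => 0), (fun _ _ _ => 0); split.
- move=> _; rewrite -J0 -I0; apply: bounded_integral_elem => i.
  exact: elem_wf_zero.
- by move=> t w i _; exact: cvg_cst.
- move=> eps delta eps0 delta0; near=> n => J' _ _ /=.
  exists set0; first by split => //; rewrite measure0 lee_fin ltW.
  move=> w _ t _; rewrite subrr mulr0 add0r /elem_int big1 ?normr0 ?ltW// => k _.
  by rewrite !subrr mulr0.
Unshelve. all: by end_near. Qed.

Lemma K_setD g h : K g -> K h -> K (fun w => g w + h w).
Proof.
move=> [mg [H [Y [[[pH aY cY [Hn [Yn [HYn HnH YnY]]]] [c Yc] gY]]]]].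
move=> [mh [H' [Y' [[[pH' aY' cY' [Hn' [Yn' [HYn' HnH' YnY']]]] [c' Yc'] hY]]]]].
split; first exact: measurable_funD.
exists (fun t w => H t w + H' t w), (fun t w => Y t w + Y' t w); split; last first.
  by apply: filterS2 gY hY => w -> ->.
split; last first.
  exists (c + c') => t tT; apply: filterS2 (Yc t tT) (Yc' t tT) => w ? ?.
  by rewrite opprD lerD.
split; [exact: predictableD|exact: adaptedD|exact: cadlagD|].
exists (fun n t w => Hn n t w + Hn' n t w), (fun n t w => Yn n t w + Yn' n t w).
split; [by move=> n; exact: bounded_integralD| |exact: emery_cvgD].
move=> t w i tT; under eq_fun do rewrite mxE.
by rewrite mxE; apply: cvgD; [exact: HnH|exact: HnH'].
Qed.

Lemma K_setZ k g : 0 <= k -> K g -> K (fun w => k * g w).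
Proof.
move=> k0 [mg [H [Y [[[pH aY cY [Hn [Yn [HYn HnH YnY]]]] [c Yc] gY]]]]].
split; first by apply: measurable_funM => //; exact: measurable_cst.
exists (fun t w => k *: H t w), (fun t w => k * Y t w); split; last first.
  by apply: filterS gY => w ->.
split; last first.
  exists (k * c) => t tT; apply: filterS (Yc t tT) => w ?.
  by rewrite -mulrN ler_wpM2l.
split; [exact: predictableZ|exact: adaptedZ|exact: (cadlagM (fun=> k))|].
exists (fun n t w => k *: Hn n t w), (fun n t w => k * Yn n t w).
split; [by move=> n; exact: bounded_integralZ| |exact: emery_cvgZ].
move=> t w i tT; under eq_fun do rewrite mxE.
by rewrite mxE; apply: cvgM; [exact: cvg_cst|exact: HnH].
Qed.

End attainable_claims.

(** * The Hahn-Banach theorem *)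

Section infima.
Context {R : realType}.
Implicit Types A B C : set R.

Lemma inf_leD A B C : A !=set0 -> B !=set0 -> has_lbound C ->
  (forall a b, A a -> B b -> exists2 c, C c & c <= a + b) ->
  inf C <= inf A + inf B.
Proof.
move=> A0 B0 lbC ABC; rewrite -lerBlDr; apply: lb_le_inf => // a Aa.
rewrite lerBlDr addrC -lerBlDr; apply: lb_le_inf => // b Bb.
have [c Cc cab] := ABC a b Aa Bb.
by rewrite lerBlDr (le_trans (ge_inf lbC Cc))// addrC.
Qed.

Lemma inf_leM A C k : 0 <= k -> A !=set0 -> has_lbound C ->
  (forall a, A a -> exists2 c, C c & c <= k * a) -> inf C <= k * inf A.
Proof.
rewrite le_eqVlt => /predU1P[<-|k0] A0 lbC AC.
  have [a Aa] := A0; have [c Cc] := AC a Aa; rewrite !mul0r.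
  by apply: le_trans; exact: ge_inf.
rewrite mulrC -ler_pdivrMr//; apply: lb_le_inf => // a Aa.
have [c Cc cka] := AC a Aa; rewrite ler_pdivrMr// mulrC.
by rewrite (le_trans (ge_inf lbC Cc)).
Qed.

End infima.

Section hahn_banach.
Context {R : realType} {V : lmodType R} (D : set V).
Hypothesis D0 : D 0.
Hypothesis DD : forall u v, D u -> D v -> D (u + v).
Hypothesis DZ : forall (c : R) u, D u -> D (c *: u).
Implicit Types (p q : V -> R) (u v w : V).

Definition sublinear_on q :=
  (forall u v, D u -> D v -> q (u + v) <= q u + q v) /\
  (forall c u, 0 <= c -> D u -> q (c *: u) <= c * q u).

Let DN u : D u -> D (- u).
Proof. by rewrite -scaleN1r; exact: DZ. Qed.

Lemma sublinear0 q : sublinear_on q -> q 0 = 0.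
Proof.
move=> [qD qZ]; apply/eqP; rewrite eq_le; apply/andP; split.
  by have := qZ 0 0 (lexx 0) D0; rewrite scaler0 mul0r.
by have := qD 0 0 D0 D0; rewrite addr0 lerDl.
Qed.

Lemma sublinear_geN q u : sublinear_on q -> D u -> - q (- u) <= q u.
Proof.
move=> sq Du; rewrite -subr_ge0 opprK -(sublinear0 sq) -(subrr u).
by case: sq => + _; apply => //; exact: DN.
Qed.

Lemma sublinearZ q c u : sublinear_on q -> 0 <= c -> D u -> q (c *: u) = c * q u.
Proof.
move=> sq c0 Du; apply/eqP; rewrite eq_le; have [_ qZ] := sq.
rewrite qZ//=; move: c0; rewrite [0 <= c]le_eqVlt => /predU1P[<-|c0].
  by rewrite mul0r scale0r (sublinear0 sq).
rewrite mulrC -ler_pdivlMr// mulrC.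
rewrite -{1}(scale1r u) -(mulVf (lt0r_neq0 c0)) -scalerA qZ ?invr_ge0 1?ltW//.
exact: DZ.
Qed.

(** The largest functional below [q] that is affine with slope [q w] along the
    rays in direction [w]: passing from [q] to it strictly lowers [q] unless
    [q (v + w) = q v + q w] for all [v]. *)
Definition straighten q w v :=
  inf [set q (v + t *: w) - t * q w | t in [set t : R | 0 <= t]].

Lemma straighten_has_lbound q w v : sublinear_on q -> D w -> D v ->
  has_lbound [set q (v + t *: w) - t * q w | t in [set t : R | 0 <= t]].
Proof.
move=> sq Dw Dv; exists (- q (- v)) => _ [t /= t0 <-].
have [qD _] := sq; have := qD _ _ (DD Dv (DZ t Dw)) (DN Dv).
by rewrite addrAC subrr add0r (sublinearZ sq t0 Dw); lra.
Qed.

Lemma straighten_le q w v t : sublinear_on q -> D w -> D v -> 0 <= t ->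
  straighten q w v <= q (v + t *: w) - t * q w.
Proof.
by move=> sq Dw Dv t0; apply: ge_inf; [exact: straighten_has_lbound|exists t].
Qed.

Lemma straighten_sublinear q w : sublinear_on q -> D w ->
  sublinear_on (straighten q w).
Proof.
move=> sq Dw; have [qD qZ] := sq.
have ne v : [set q (v + t *: w) - t * q w | t in [set t : R | 0 <= t]] !=set0.
  by exists (q (v + 0 *: w) - 0 * q w); exists 0 => /=.
split=> [u v Du Dv|c u c0 Du].
  apply: inf_leD => //.
    by apply: straighten_has_lbound => //; exact: DD.
  move=> _ _ [s /= s0 <-] [t /= t0 <-].
  exists (q (u + v + (s + t) *: w) - (s + t) * q w).
    by exists (s + t) => //=; exact: addr_ge0.
  rewrite scalerDl mulrDl opprD [leRHS]addrACA lerD2r addrACA.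
  by apply: qD; apply: DD => //; exact: DZ.
apply: inf_leM => //.
  by apply: straighten_has_lbound => //; exact: DZ.
move=> _ [t /= t0 <-]; exists (q (c *: u + (c * t) *: w) - (c * t) * q w).
  by exists (c * t) => //=; exact: mulr_ge0.
rewrite mulrBr mulrA lerD2r -scalerA -scalerDr; apply: qZ => //.
by apply: DD => //; exact: DZ.
Qed.

(** The lower bound [- p (- v)] shared by all sublinear functionals below [p]
    keeps the infimum finite, and two members of a chain have a smaller one that
    serves both summands. *)
Lemma chain_inf_sublinear p (Q : set (V -> R)) : Q !=set0 ->
  (forall q, Q q -> sublinear_on q /\ forall v, D v -> q v <= p v) ->
  (forall q q', Q q -> Q q' -> (forall v, D v -> q v <= q' v) \/
                               (forall v, D v -> q' v <= q v)) ->
  [/\ sublinear_on (fun v => inf [set q v | q in Q]),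
      (forall v, D v -> inf [set q v | q in Q] <= p v) &
      (forall q v, Q q -> D v -> inf [set q v | q in Q] <= q v)].
Proof.
move=> [q0 Qq0] Qp Qtot.
have lb v : D v -> has_lbound [set q v | q in Q].
  move=> Dv; exists (- p (- v)) => _ [q Qq <-]; have [sq qp] := Qp q Qq.
  by rewrite (le_trans _ (sublinear_geN sq Dv))// lerN2 qp//; exact: DN.
have ne v : [set q v | q in Q] !=set0 by exists (q0 v); exists q0.
have inf_le q v : Q q -> D v -> inf [set q v | q in Q] <= q v.
  by move=> Qq Dv; apply: ge_inf; [exact: lb|exists q].
split => //; last first.
  move=> v Dv; rewrite (le_trans (inf_le q0 v Qq0 Dv))//.
  by have [_] := Qp q0 Qq0; exact.
split=> [u v Du Dv|c u c0 Du].
  apply: inf_leD => //; first exact/lb/DD.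
  move=> _ _ [q Qq <-] [q' Qq' <-].
  have [[qD _] _] := Qp q Qq; have [[qD' _] _] := Qp q' Qq'.
  have [qq'|q'q] := Qtot q q' Qq Qq'.
    exists (q (u + v)); first by exists q.
    by rewrite (le_trans (qD u v Du Dv))// lerD2l qq'.
  exists (q' (u + v)); first by exists q'.
  by rewrite (le_trans (qD' u v Du Dv))// lerD2r q'q.
apply: inf_leM => //; first exact/lb/DZ.
move=> _ [q Qq <-]; exists (q (c *: u)); first by exists q.
by have [[_ qZ] _] := Qp q Qq; exact: qZ.
Qed.

Lemma minimal_sublinear_linear q : sublinear_on q ->
  (forall q', sublinear_on q' -> (forall v, D v -> q' v <= q v) ->
     forall v, D v -> q v <= q' v) ->
  (forall u v, D u -> D v -> q (u + v) = q u + q v) /\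
  (forall c u, D u -> q (c *: u) = c * q u).
Proof.
move=> sq qmin; have [qD _] := sq.
have qDE u v : D u -> D v -> q (u + v) = q u + q v.
  move=> Du Dv; apply/eqP; rewrite eq_le qD//= -lerBrDr.
  have le0 w : D w -> straighten q v w <= q w.
    move=> Dw; have := straighten_le sq Dv Dw (lexx 0).
    by rewrite scale0r addr0 mul0r subr0.
  rewrite (le_trans (qmin _ (straighten_sublinear sq Dv) le0 u Du))//.
  by have := straighten_le sq Dv Du ler01; rewrite scale1r mul1r.
split=> // c u Du; have [c0|/ltW c0] := leP 0 c; first exact: sublinearZ.
apply/eqP; rewrite -subr_eq0 -mulNr -(sublinearZ sq _ Du) ?oppr_ge0//.
by rewrite -qDE; [rewrite scaleNr subrr (sublinear0 sq)|exact: DZ|exact: DZ].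
Qed.

(** A minimal sublinear functional is linear, since straightening it along any
    vector cannot lower it any further. Starting below [p] straightened along
    [w] forces the value [- p w] at [- w]. *)
Theorem hahn_banach p w : sublinear_on p -> D w -> exists phi : V -> R,
  [/\ (forall u v, D u -> D v -> phi (u + v) = phi u + phi v),
      (forall c u, D u -> phi (c *: u) = c * phi u),
      (forall u, D u -> phi u <= p u) & phi w = p w].
Proof.
move=> sp Dw; pose pw := straighten p w.
pose S := {q | sublinear_on q /\ forall v, D v -> q v <= pw v}.
pose above (q q' : S) := `[< forall v, D v -> sval q' v <= sval q v >].
have spw : sublinear_on pw by exact: straighten_sublinear.
pose pw0 : S := exist _ pw (conj spw (fun v _ => lexx (pw v))).
have [||A Atot|[q [sq qpw]] qmax] := @ZL_preorder S pw0 above.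
- by move=> q; apply/asboolP.
- move=> q1 q2 q3 /asboolP q12 /asboolP q23; apply/asboolP => v Dv.
  by rewrite (le_trans (q23 v Dv))// q12.
- have [->|/set0P[q0 Aq0]] := eqVneq A set0; first by exists pw0.
  have [|_ [q _ <-]|_ _ [q Aq <-] [q' Aq' <-]|sQ Qpw Qle] :=
      @chain_inf_sublinear pw [set sval q | q in A].
  + by exists (sval q0); exists q0.
  + exact: (svalP q).
  + by have [/asboolP|/asboolP] := Atot _ _ Aq Aq'; [right|left].
  + pose qi : S := exist _ (fun v => inf [set q v | q in [set sval q | q in A]])
      (conj sQ Qpw).
    exists qi => q Aq; apply/asboolP => v Dv /=.
    by apply: Qle => //; exists q.
- have [|qD qZ] := minimal_sublinear_linear sq.
    move=> q' sq' q'q; have q'pw v : D v -> q' v <= pw v.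
      by move=> Dv; rewrite (le_trans (q'q v Dv))// qpw.
    have := qmax (exist _ q' (conj sq' q'pw)).
    by move=> /(_ (introT (asboolP _) q'q))/asboolP.
  have qp v t : D v -> 0 <= t -> q v <= p (v + t *: w) - t * p w.
    by move=> Dv t0; rewrite (le_trans (qpw v Dv))// straighten_le.
  have qlep u : D u -> q u <= p u.
    by move=> Du; have := qp u 0 Du (lexx 0); rewrite scale0r addr0 mul0r subr0.
  exists q; split => //; apply/eqP; rewrite eq_le qlep//=.
  have := qp (- w) 1 (DN Dw) ler01.
  by rewrite scale1r addNr (sublinear0 sp) mul1r sub0r -scaleN1r qZ// mulN1r lerN2.
Qed.

End hahn_banach.

(** * Integrable functions *)

Section L1_functions.
Context {R : realType} {disp : measure_display} {Omega : measurableType disp}.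
Variable Q : probability Omega R.
Implicit Types (u v : Omega -> R) (A : set Omega).

Local Notation E := (Rintegral Q setT).

Lemma L1_measurable u : L1 Q u -> measurable_fun setT u.
Proof. by move=> /measurable_int /measurable_EFinP. Qed.

Lemma L1D u v : L1 Q u -> L1 Q v -> L1 Q (fun w => u w + v w).
Proof. exact: integrableD. Qed.

Lemma L1Z c u : L1 Q u -> L1 Q (fun w => c * u w).
Proof. exact: integrableZl. Qed.

Lemma L1B u v : L1 Q u -> L1 Q v -> L1 Q (fun w => u w - v w).
Proof. exact: integrableB. Qed.

Lemma L1_norm u : L1 Q u -> L1 Q (fun w => `|u w|).
Proof. exact: integrable_norm. Qed.

Lemma L1_cst c : L1 Q (fun=> c).
Proof. exact: finite_measure_integrable_cst. Qed.

Lemma L1_indic A : measurable A -> L1 Q \1_A.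
Proof. exact: integrable_indic. Qed.

Lemma L1_max0 u : L1 Q u -> L1 Q (fun w => Num.max (u w) 0).
Proof.
move=> iu; rewrite (_ : (fun _ => _) = u^\+%R)//.
exact: integrable_funrpos.
Qed.

Lemma L1_sum n (h : 'I_n -> Omega -> R) :
  (forall i, L1 Q (h i)) -> L1 Q (fun w => \sum_(i < n) h i w).
Proof.
elim: n h => [|n IH] h ih.
  rewrite (_ : (fun _ => _) = fun=> 0); first exact: L1_cst.
  by apply/funext => w; rewrite big_ord0.
rewrite (_ : (fun _ => _) = fun w =>
    \sum_(i < n) h (widen_ord (leqnSn n) i) w + h ord_max w).
  by apply: L1D => //; exact: IH.
by apply/funext => w; rewrite big_ord_recr.
Qed.

Lemma RintD u v : L1 Q u -> L1 Q v -> E (fun w => u w + v w) = E u + E v.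
Proof. exact: RintegralD. Qed.

Lemma RintB u v : L1 Q u -> L1 Q v -> E (fun w => u w - v w) = E u - E v.
Proof. exact: RintegralB. Qed.

Lemma RintZ c u : L1 Q u -> E (fun w => c * u w) = c * E u.
Proof. by move=> iu; exact: RintegralZl. Qed.

Lemma Rint_cst c : E (fun=> c) = c.
Proof.
rewrite Rintegral_cst//; transitivity (c * fine 1%E); last exact: mulr1.
by congr (_ * fine _); exact: probability_setT.
Qed.

Lemma le_Rint u v : L1 Q u -> L1 Q v -> (forall w, u w <= v w) -> E u <= E v.
Proof. by move=> iu iv uv; exact: le_Rintegral. Qed.

Lemma Rint_ge0 u : (forall w, 0 <= u w) -> 0 <= E u.
Proof. by move=> u0; exact: Rintegral_ge0. Qed.

Lemma expectation_Rint u : L1 Q u -> 'E_Q[u]%E = (E u)%:E.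
Proof.
by move=> iu; rewrite unlock fineK//; exact: (integrable_fin_num measurableT iu).
Qed.

Lemma Rint_indic A : measurable A -> (E \1_A)%:E = Q A.
Proof.
move=> mA; rewrite /Rintegral integral_indic// setIT fineK//.
exact: fin_num_measure.
Qed.

Lemma ae_le_Rint u v : L1 Q u -> L1 Q v ->
  {ae Q, forall w, u w <= v w} -> E u <= E v.
Proof.
move=> iu iv uv; rewrite -subr_ge0 -RintB// /Rintegral.
rewrite (ae_eq_integral (fun w => `|v w - u w|%:E)) //.
- by apply: fine_ge0; apply: integral_ge0 => w _; rewrite lee_fin.
- by apply: measurable_int; exact: (L1B iv iu).
- by apply: measurable_int; exact: L1_norm (L1B iv iu).
- by apply: filterS uv => w uvw _; rewrite ger0_norm// subr_ge0.
Qed.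

(** Linearity extends the vanishing to simple functions, which are dense in
    $L^1$. *)
Lemma L1_functional_eq0 (delta : (Omega -> R) -> R) M :
  (forall u v, L1 Q u -> L1 Q v -> delta (fun w => u w + v w) = delta u + delta v) ->
  (forall c u, L1 Q u -> delta (fun w => c * u w) = c * delta u) ->
  (forall u, L1 Q u -> `|delta u| <= M * E (fun w => `|u w|)) ->
  (forall A, measurable A -> delta \1_A = 0) ->
  forall u, L1 Q u -> delta u = 0.
Proof.
move=> dD dZ dM d0 u iu.
have d_sum n (h : 'I_n -> Omega -> R) : (forall i, L1 Q (h i)) ->
    delta (fun w => \sum_(i < n) h i w) = \sum_(i < n) delta (h i).
  elim: n h => [|n IH] h ih.
    rewrite big_ord0 (_ : (fun _ => _) = fun w => 0 * cst 0 w).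
      by rewrite dZ ?mul0r//; exact: L1_cst.
    by apply/funext => w; rewrite big_ord0 mul0r.
  rewrite (_ : (fun _ => _) = fun w =>
      \sum_(i < n) h (widen_ord (leqnSn n) i) w + h ord_max w).
    by rewrite dD//; [rewrite IH// big_ord_recr|exact: L1_sum].
  by apply/funext => w; rewrite big_ord_recr.
have [g [ig _ ug0]] := approximation_sfun_integrable measurableT iu.
have dg n : delta (g n) = 0.
  pose s : seq R := finmap.enum_fset (fset_set (range (g n))).
  rewrite (_ : (g n : Omega -> R) = fun w =>
      \sum_(i < size s) s`_i * \1_(g n @^-1` [set s`_i]) w).
    rewrite d_sum => [|i]; last exact/L1Z/L1_indic.
    by rewrite big1// => i _; rewrite dZ ?d0 ?mulr0//; exact: L1_indic.
  by apply/funext => w; exact: fimfunEord.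
apply/eqP; rewrite -normr_le0; apply/ler_addgt0Pl => e e0; rewrite addr0.
have M1 : 0 < `|M| + 1 by rewrite ltr_wpDl.
have /fine_cvgP[_ /cvgrPdist_lt/(_ _ (divr_gt0 e0 M1))[n _ /(_ n (leqnn n))]] := ug0.
rewrite /= sub0r normrN => ugn.
have -> : delta u = delta (fun w => u w - g n w).
  rewrite (_ : (fun w => u w - g n w) = fun w => u w + -1 * g n w).
    by rewrite dD ?dZ ?dg ?mulr0 ?addr0//; [exact: ig|exact: L1Z (ig n)].
  by apply/funext => w; rewrite mulN1r.
have iug : L1 Q (fun w => u w - g n w) by exact: L1B (ig n).
rewrite (le_trans (dM _ iug))// (le_trans (ler_wpM2r _ (ler_norm M)))//.
  exact: Rint_ge0.
rewrite (le_trans (ler_wpM2l _ (ltW (le_lt_trans (ler_norm _) ugn))))//.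
by rewrite mulrCA ler_piMr ?(ltW e0)// ler_pdivrMr// mul1r lerDl.
Qed.

End L1_functions.

(** * Positive functionals on integrable functions *)

Section functional_measure.
Context {R : realType} {disp : measure_display} {Omega : measurableType disp}.
Variables (Q : probability Omega R) (psi : (Omega -> R) -> R) (M : R).
Hypothesis psiD : forall u v, L1 Q u -> L1 Q v ->
  psi (fun w => u w + v w) = psi u + psi v.
Hypothesis psiZ : forall c u, L1 Q u -> psi (fun w => c * u w) = c * psi u.
Hypothesis psi_ge0 : forall u, L1 Q u -> (forall w, 0 <= u w) -> 0 <= psi u.
Hypothesis psi_le : forall u, L1 Q u -> (forall w, 0 <= u w) ->
  psi u <= M * Rintegral Q setT u.
Hypothesis psi1 : psi (fun=> 1) = 1.

(** The cut-off at [0] only matters on non-measurable sets, where [psi] is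
    unconstrained. *)
Definition functional_measure (A : set Omega) : \bar R :=
  (Num.max (psi \1_A) 0)%:E.

Let functional_measureE A : measurable A ->
  functional_measure A = (psi \1_A)%:E.
Proof.
by move=> mA; rewrite /functional_measure max_l// psi_ge0//; exact: L1_indic.
Qed.

Let functional_measure0 : functional_measure set0 = 0%E.
Proof.
rewrite functional_measureE// (_ : \1_set0 = fun w => 0 * cst 0 w).
  by rewrite psiZ ?mul0r//; exact: L1_cst.
by apply/funext => w; rewrite indic0 mul0r.
Qed.

Let functional_measure_ge0 A : (0 <= functional_measure A)%E.
Proof. by rewrite lee_fin le_max lexx orbT. Qed.

Let indicU_disjoint (A B : set Omega) : A `&` B = set0 ->
  \1_(A `|` B) = (fun w => \1_A w + \1_B w) :> (Omega -> R).
Proof.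
move=> AB; apply/funext => w; rewrite !indicE in_setU.
have [wA|wA] := boolP (w \in A); rewrite ?add0r//=.
rewrite (_ : w \in B = false) ?addr0//; apply/negP => wB.
have : (A `&` B) w by split; exact: set_mem.
by rewrite AB.
Qed.

(** The mass of the tail of a disjoint union is at most [M] times its
    [Q]-probability, which vanishes. *)
Let functional_measure_sigma_additive : semi_sigma_additive functional_measure.
Proof.
move=> F mF tF mUF.
pose B n := \big[setU/set0]_(i < n) F i.
have mB n : measurable (B n) by exact: bigsetU_measurable.
have BSE n : B n.+1 = B n `|` F n by rewrite /B big_ord_recr.
have BF n : B n `&` F n = set0.
  rewrite /B big_distrl/= big1// => i _.
  by move/trivIsetP : tF => /(_ i n Logic.I Logic.I); apply; rewrite ltn_eqF.
have sumB (nu : set Omega -> \bar R) : nu set0 = 0%E ->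
    (forall n, nu (B n.+1) = nu (B n) + nu (F n))%E ->
    forall n, (\sum_(0 <= i < n) nu (F i))%E = nu (B n).
  move=> nu0 nuS; elim=> [|n IH]; first by rewrite big_geq// /B big_ord0 nu0.
  by rewrite big_nat_recr//= IH nuS.
have sumQ n : (\sum_(0 <= i < n) Q (F i))%E = Q (B n).
  by apply: sumB => // {}n; rewrite BSE measureU.
have summu n : (\sum_(0 <= i < n) functional_measure (F i))%E = (psi \1_(B n))%:E.
  rewrite (sumB _ functional_measure0) ?functional_measureE// => {}n.
  rewrite !functional_measureE// BSE indicU_disjoint// psiD//; exact: L1_indic.
rewrite functional_measureE//; under eq_fun do rewrite summu.
apply/fine_cvgP; split; first by near=> n.
have QB : fine (Q (B n)) @[n --> \oo] --> fine (Q (\bigcup_n F n)).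
  apply: fine_cvg; rewrite fineK; last exact: fin_num_measure.
  have := @measure_semi_sigma_additive _ _ _ Q F mF tF mUF.
  by under eq_fun do rewrite sumQ.
have M0 : 0 <= M.
  have := psi_le (L1_cst Q 1) (fun=> ler01).
  by rewrite psi1 Rint_cst mulr1; apply: le_trans.
apply/cvgrPdist_le => e e0.
have M1 : 0 < M + 1 by rewrite ltr_wpDl.
move/cvgrPdist_le : QB => /(_ _ (divr_gt0 e0 M1)); apply: filterS => n.
have splitF : \bigcup_n F n = B n `|` (\bigcup_n F n `\` B n).
  rewrite setDUK// => w; rewrite /B -bigcup_mkord => -[i _ Fi].
  by exists i.
have mD : measurable (\bigcup_n F n `\` B n) by exact: measurableD.
have dD : B n `&` (\bigcup_n F n `\` B n) = set0 by rewrite setDIK.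
have iB : L1 Q \1_(B n) by exact: L1_indic.
have iD : L1 Q \1_(\bigcup_n F n `\` B n) by exact: L1_indic.
rewrite {1 2}splitF /= indicU_disjoint// psiD// addrAC subrr add0r.
rewrite measureU// fineD ?fin_num_measure// addrAC subrr add0r => QD.
rewrite ger0_norm ?psi_ge0// (le_trans (psi_le iD _))//.
have -> : Rintegral Q setT \1_(\bigcup_n F n `\` B n) =
    fine (Q (\bigcup_n F n `\` B n)) by rewrite -Rint_indic.
rewrite (le_trans (ler_wpM2l M0 (le_trans (ler_norm _) QD)))//.
by rewrite mulrCA ler_piMr ?(ltW e0)// ler_pdivrMr// mul1r lerDl.
Unshelve. all: by end_near. Qed.

HB.instance Definition _ := isMeasure.Build _ _ _ functional_measure
  functional_measure0 functional_measure_ge0 functional_measure_sigma_additive.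

Let functional_measure_setT : functional_measure setT = 1%E.
Proof. by rewrite functional_measureE// indicT psi1. Qed.

HB.instance Definition _ :=
  Measure_isProbability.Build _ _ _ functional_measure functional_measure_setT.

(** The expectation under the constructed measure and [psi] are continuous linear
    functionals on $L^1(Q)$ that agree on indicators. *)
Theorem functional_representation : exists Q' : probability Omega R,
  forall u, L1 Q u -> L1 Q' u /\ Rintegral Q' setT u = psi u.
Proof.
pose Q' : probability Omega R := functional_measure.
have M0 : 0 <= M.
  have := psi_le (L1_cst Q 1) (fun=> ler01).
  by rewrite psi1 Rint_cst mulr1; apply: le_trans.
have Q'E A : measurable A -> Q' A = (psi \1_A)%:E by exact: functional_measureE.
have Q'Q A : measurable A -> (Q' A <= mscale (NngNum M0) Q A)%E.
  move=> mA; rewrite Q'E// /mscale /= -Rint_indic// -EFinM lee_fin.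
  by apply: psi_le => //; exact: L1_indic.
have intQ' (u : Omega -> R) : measurable_fun setT u ->
    (\int[Q']_w `|(u w)%:E| <= M%:E * \int[Q]_w `|(u w)%:E|)%E.
  move=> mu; rewrite -[M]/((NngNum M0)%:num) -ge0_integral_mscale//.
    apply: ge0_le_measure_integral => //.
    by apply: measurableT_comp => //; exact/measurable_EFinP.
  by apply: measurableT_comp => //; exact/measurable_EFinP.
have L1Q' (u : Omega -> R) : L1 Q u -> L1 Q' u.
  move=> iu; have mu := L1_measurable iu.
  apply/integrableP; split; first exact/measurable_EFinP.
  rewrite (le_lt_trans (intQ' _ mu))// lte_mul_pinfty// ?lee_fin//.
  by have /integrableP[] := iu.
exists Q' => u iu; split; first exact: L1Q'.
apply/eqP; rewrite -subr_eq0; apply/eqP.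
apply: (L1_functional_eq0 (Q := Q) (M := M + M)
  (delta := fun u => Rintegral Q' setT u - psi u)) => //.
- move=> v v' iv iv'; rewrite RintD ?psiD//; [by rewrite opprD addrACA| |];
    exact: L1Q'.
- by move=> c v iv; rewrite RintZ ?psiZ ?mulrBr//; exact: L1Q'.
- move=> v iv; rewrite (le_trans (ler_normB _ _))// mulrDl lerD//.
    rewrite (le_trans (le_normr_Rintegral measurableT (L1Q' _ iv)))//.
    rewrite -lee_fin EFinM /Rintegral !fineK.
    + exact: (intQ' _ (L1_measurable iv)).
    + exact: (integrable_fin_num measurableT (L1_norm iv)).
    + exact: (integrable_fin_num measurableT (L1_norm (L1Q' _ iv))).
  have iN : L1 Q (fun w => `|v w|) by exact: L1_norm.
  have psi_mono v1 v2 : L1 Q v1 -> L1 Q v2 -> (forall w, v1 w <= v2 w) ->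
      psi v1 <= psi v2.
    move=> i1 i2 v12; rewrite -subr_ge0.
    have -> : psi v2 - psi v1 = psi (fun w => v2 w + -1 * v1 w).
      by rewrite psiD ?psiZ ?mulN1r//; exact: L1Z.
    apply: psi_ge0 => [|w]; first exact: L1D (L1Z _ _).
    by rewrite mulN1r subr_ge0.
  rewrite (le_trans _ (psi_le iN _))// ler_norml; apply/andP; split; last first.
    by apply: psi_mono => // w; exact: ler_norm.
  rewrite -mulN1r -psiZ//; apply: psi_mono => // [|w]; first exact: L1Z.
  by rewrite mulN1r lerNl -normrN ler_norm.
- move=> A mA; apply/eqP; rewrite subr_eq0; apply/eqP.
  by apply: EFin_inj; rewrite -Q'E// Rint_indic.
Qed.

End functional_measure.

(** * Convex functions on the positive half-line *)

Section convex_growth.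
Context {R : realType}.
Variable Phi : R -> R.
Hypothesis Phi_convex : convex_function (E := R^o) `]0, +oo[ Phi.

Lemma convex_le x y s t : 0 < x -> 0 < y -> 0 <= s -> 0 <= t -> s + t = 1 ->
  Phi (s * x + t * y) <= s * Phi x + t * Phi y.
Proof.
move=> x0 y0 s0 t0 st1; have s1 : s <= 1 by rewrite -st1 lerDl.
pose si : {i01 R} := Itv01 s0 s1.
have := Phi_convex si (x := x) (y := y).
rewrite !inE /= !in_itv /= !andbT => /(_ x0 y0).
by have <- : 1 - s = t; [rewrite -st1 addrAC subrr add0r|exact].
Qed.

(** The point [1] lies between [y] and [2] when [y <= 1], and between [1/2] and
    [y] otherwise; in both cases convexity bounds [Phi y] from below by an affine
    function of [y]. *)
Lemma convex_affine_minorant : exists A B : R, [/\ 0 <= A, 0 <= B &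
  forall y, 0 < y -> - (A + B * y) <= Phi y].
Proof.
pose s := `|Phi 2 - Phi 1| + 2 * `|Phi 1 - Phi 2^-1|.
have s0 : 0 <= s by rewrite addr_ge0// mulr_ge0.
exists (`|Phi 1| + s), s; split => // [|y y0]; first by rewrite addr_ge0.
have n1 := ler_norm (Phi 2 - Phi 1); have n2 := ler_norm (Phi 1 - Phi 2^-1).
have n3 : - `|Phi 1| <= Phi 1 by rewrite lerNl -normrN ler_norm.
have m1 := normr_ge0 (Phi 2 - Phi 1); have m2 := normr_ge0 (Phi 1 - Phi 2^-1).
have [y1|y1] := leP y 1.
  have d0 : 0 < 2 - y by lra.
  have d1 : (2 - y) != 0 by rewrite gt_eqF.
  have := @convex_le y 2 (2 - y)^-1 ((1 - y) / (2 - y)) y0 ltac:(lra).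
  rewrite invr_ge0 (ltW d0) divr_ge0 ?(ltW d0) ?subr_ge0// => /(_ isT isT).
  have -> : (2 - y)^-1 + (1 - y) / (2 - y) = 1.
    by rewrite -[X in X + _]mul1r -mulrDl (_ : 1 + (1 - y) = 2 - y) ?divff//; lra.
  have -> : (2 - y)^-1 * y + (1 - y) / (2 - y) * 2 = 1.
    rewrite mulrC -mulrA [_^-1 * 2]mulrC mulrA -mulrDl.
    by rewrite (_ : y + (1 - y) * 2 = 2 - y) ?divff//; lra.
  move=> /(_ erefl); rewrite -(ler_pM2l d0) mulrDr mulrA divff// mul1r.
  rewrite mulrA mulrCA divff// mulr1 => H.
  have : (1 - y) * (Phi 2 - Phi 1) <= 1 * `|Phi 2 - Phi 1|.
    apply: (@le_trans _ _ ((1 - y) * `|Phi 2 - Phi 1|)).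
      by apply: ler_wpM2l => //; lra.
    by apply: ler_wpM2r => //; lra.
  have : 0 <= s * y by rewrite mulr_ge0// ltW.
  rewrite /s in s0 *; lra.
have d0 : 0 < 2 * y - 1 by lra.
have d1 : (2 * y - 1) != 0 by rewrite gt_eqF.
have := @convex_le y 2^-1 (2 * y - 1)^-1 ((2 * y - 2) / (2 * y - 1)) y0 ltac:(lra).
rewrite invr_ge0 (ltW d0) divr_ge0 ?(ltW d0)//; last lra.
move=> /(_ isT isT).
have -> : (2 * y - 1)^-1 + (2 * y - 2) / (2 * y - 1) = 1.
  by rewrite -[X in X + _]mul1r -mulrDl (_ : 1 + _ = 2 * y - 1) ?divff//; lra.
have -> : (2 * y - 1)^-1 * y + (2 * y - 2) / (2 * y - 1) * 2^-1 = 1.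
  rewrite mulrC -mulrA [_^-1 * 2^-1]mulrC mulrA -mulrDl.
  by rewrite (_ : y + (2 * y - 2) * 2^-1 = 2 * y - 1) ?divff//; lra.
move=> /(_ erefl); rewrite -(ler_pM2l d0) mulrDr mulrA divff// mul1r.
rewrite mulrA mulrCA divff// mulr1 => H.
have : (2 * y - 2) * - `|Phi 1 - Phi 2^-1| <= (2 * y - 2) * (Phi 1 - Phi 2^-1).
  apply: ler_wpM2l; first lra.
  by rewrite lerNl -normrN ler_norm.
have : 0 <= `|Phi 2 - Phi 1| * y by rewrite mulr_ge0// ltW.
rewrite /s in s0 *; lra.
Qed.

(** The sublevel sets of a convex function are intervals. *)
Lemma measurable_convex : measurable_fun (`]0, +oo[ : set R) Phi.
Proof.
move=> mD; apply: (measurability _ (RGenInftyO.measurableE R)) => //.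
move=> _ [_ [c ->] <-]; apply: is_interval_measurable => x z [].
rewrite /= !in_itv/= !andbT => x0 xc [z0 zc] y /andP[xy yz].
rewrite /= !in_itv/= andbT; have y0 : 0 < y := lt_le_trans x0 xy.
have [xz|zx] := ltP x z; last first.
  by have -> : y = x by apply/eqP; rewrite eq_le xy (le_trans yz).
split => //; have d0 : 0 < z - x by rewrite subr_gt0.
have d1 : (z - x) != 0 by rewrite gt_eqF.
have ab1 : (z - y) / (z - x) + (y - x) / (z - x) = 1.
  by rewrite -mulrDl (_ : z - y + (y - x) = z - x) ?divff//; lra.
have := @convex_le x z ((z - y) / (z - x)) ((y - x) / (z - x)) x0 z0.
rewrite !divr_ge0 ?subr_ge0 ?(ltW xz)// => /(_ isT isT ab1).
have -> : (z - y) / (z - x) * x + (y - x) / (z - x) * z = y.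
  rewrite mulrAC [X in _ + X]mulrAC -mulrDl.
  have -> : (z - y) * x + (y - x) * z = y * (z - x).
    by rewrite !mulrBl mulrBr (mulrC z x); lra.
  by rewrite mulfK.
pose m := Num.max (Phi x) (Phi z).
move=> /le_lt_trans; apply; apply: (@le_lt_trans _ _ m); last by rewrite gt_max xc.
rewrite -[m]mul1r -ab1 [leRHS]mulrDl lerD// ler_wpM2l ?le_max ?lexx ?orbT//;
  by rewrite divr_ge0 ?subr_ge0 ?(ltW xz).
Qed.

End convex_growth.

(** * Comparable probabilities and their densities *)

Section densities.
Context {R : realType} {disp : measure_display} {Omega : measurableType disp}.
Variable P : probability Omega R.
Implicit Types Q : probability Omega R.

(** Integrating over the set where [v < u] shows that the positive part of
    [u - v] has integral [0]. *)
Lemma ae_le_of_integrals (u v : Omega -> R) : L1 P u -> L1 P v ->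
  (forall A, measurable A ->
     (\int[P]_(w in A) (u w)%:E <= \int[P]_(w in A) (v w)%:E)%E) ->
  {ae P, forall w, u w <= v w}.
Proof.
move=> iu iv uv; pose h w := Num.max (u w - v w) 0.
have ih : L1 P h by apply/L1_max0/L1B.
pose A := [set w | v w < u w].
have mA : measurable A.
  have := measurable_fun_ltr (L1_measurable iv) (L1_measurable iu).
  by move=> /(_ measurableT [set true]); rewrite setTI; exact.
have h0 : (\int[P]_w `|(h w)%:E| = 0)%E.
  have -> : (\int[P]_w `|(h w)%:E| = \int[P]_(w in A) (u w - v w)%:E)%E.
    rewrite [RHS]integral_mkcond; apply: eq_integral => w _.
    rewrite /= ger0_norm ?le_max ?lexx ?orbT// /h patchE; case: ifPn.
      by rewrite inE /A /= => vu; rewrite max_l// subr_ge0 ltW.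
    by rewrite notin_setE /A /= => /negP; rewrite -leNgt => uv'; rewrite max_r// subr_le0.
  have iuA : P.-integrable A (EFin \o u) by apply: integrableS iu.
  have ivA : P.-integrable A (EFin \o v) by apply: integrableS iv.
  apply/eqP; rewrite eq_le; apply/andP; split; last first.
    by apply: integral_ge0 => w; rewrite /A /= => vu; rewrite lee_fin subr_ge0 ltW.
  rewrite integralB_EFin// sube_le0; exact: uv.
have mh : measurable_fun setT (EFin \o h) by exact: measurable_int ih.
move/(ae_eq_integral_abs _ measurableT mh) : h0; apply: filterS => w /(_ Logic.I) [].
rewrite /h => h0; rewrite -subr_le0.
by have : u w - v w <= Num.max (u w - v w) 0; [rewrite le_max lexx|rewrite h0].
Qed.

Lemma density_L1 Q : Q `<< P -> L1 P (density P Q).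
Proof.
move=> QP; rewrite /L1 /=.
rewrite (_ : EFin \o density P Q = Radon_Nikodym (charge_of_finite_measure Q) P).
  exact: Radon_Nikodym_integrable.
by apply/funext => w; rewrite /density /= fineK// Radon_Nikodym_fin_num.
Qed.

Lemma integral_density Q A : Q `<< P -> measurable A ->
  (\int[P]_(w in A) (density P Q w)%:E = Q A)%E.
Proof.
move=> QP mA; transitivity (charge_of_finite_measure Q A) => //.
rewrite (@Radon_Nikodym_integral _ _ _ (charge_of_finite_measure Q) P A QP mA).
apply: eq_integral => w _.
by rewrite /density fineK// Radon_Nikodym_fin_num.
Qed.

Lemma density_ge0 Q : Q `<< P -> {ae P, forall w, 0 <= density P Q w}.
Proof.
move=> QP; apply: ae_le_of_integrals; [exact: L1_cst|exact: density_L1|].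
by move=> A mA; rewrite integral_density// integral0 measure_ge0.
Qed.

Lemma density_leZl c Q Q' : Q `<< P -> Q' `<< P ->
  (forall A, measurable A -> (c%:E * Q A <= Q' A)%E) ->
  {ae P, forall w, c * density P Q w <= density P Q' w}.
Proof.
move=> QP Q'P cQQ'; apply: ae_le_of_integrals.
- exact/L1Z/density_L1.
- exact: density_L1.
- move=> A mA; under eq_integral do rewrite EFinM.
  rewrite integralZl//; last by apply: (integrableS measurableT) => //; exact: density_L1.
  by rewrite !integral_density// cQQ'.
Qed.

Lemma density_leZr c Q Q' : Q `<< P -> Q' `<< P ->
  (forall A, measurable A -> (Q' A <= c%:E * Q A)%E) ->
  {ae P, forall w, density P Q' w <= c * density P Q w}.
Proof.
move=> QP Q'P cQQ'; apply: ae_le_of_integrals.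
- exact: density_L1.
- exact/L1Z/density_L1.
- move=> A mA; under [leRHS]eq_integral do rewrite EFinM.
  rewrite integralZl//; last by apply: (integrableS measurableT) => //; exact: density_L1.
  by rewrite !integral_density// cQQ'.
Qed.

Variable Phi : R -> R.
Hypothesis Phi_convex : convex_function (E := R^o) `]0, +oo[ Phi.
Hypothesis Phi_growth : growth_condition Phi.

Lemma measurable_Phi_ext (q : Omega -> R) : measurable_fun setT q ->
  measurable_fun setT (fun w => Phi_ext Phi (q w)).
Proof.
move=> mq; apply: measurable_fun_if => //.
- by apply: measurable_fun_ltr => //; exact: measurable_cst.
- apply/measurable_EFinP; apply: (measurable_comp (F := (`]0, +oo[ : set R))) => //.
  + by move=> _ [w [_ /= q0] <-]; rewrite /= in_itv/= andbT q0.
  + exact: measurable_convex.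
  + exact: measurable_funS mq.
Qed.

(** Where the density of [Q] vanishes both densities do, and [Phi_ext] takes the
    same value at both; elsewhere the growth condition bounds the positive part
    and an affine minorant of the convex function the negative part. *)
Lemma Phi_ext_integrable_comparable Q Q' a b : Q `<< P -> Q' `<< P ->
  0 < a -> a <= b ->
  (forall A, measurable A -> (a%:E * Q A <= Q' A)%E) ->
  (forall A, measurable A -> (Q' A <= b%:E * Q A)%E) ->
  P.-integrable setT (fun w => Phi_ext Phi (density P Q w)) ->
  P.-integrable setT (fun w => Phi_ext Phi (density P Q' w)).
Proof.
move=> QP Q'P a0 ab aQ bQ iQ.
have [alpha [beta [al0 be0 growth]]] := Phi_growth a0 ab.
have [A [B [A0 B0 PhiAB]]] := convex_affine_minorant Phi_convex.
pose q := density P Q; pose q' := density P Q'.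
pose al := Num.max alpha 1; pose h w := beta * (`|q w| + 1) + (A + B * `|q' w|).
have al1 : 1 <= al by rewrite le_max lexx orbT.
have alal : alpha <= al by rewrite le_max lexx.
have ih : L1 P h.
  by apply: L1D; [apply/L1Z/L1D|apply/L1D; last apply/L1Z];
    rewrite ?L1_cst//; [exact/L1_norm/density_L1|exact: L1_cst|exact: L1_cst|
    exact/L1_norm/density_L1].
pose g w := (al%:E * `|Phi_ext Phi (q w)| + (h w)%:E)%E.
have ig : P.-integrable setT g.
  by apply: integrableD => //; apply: integrableZl => //; exact: integrable_abse.
have mPhi : measurable_fun setT (fun w => Phi_ext Phi (q' w)).
  exact/measurable_Phi_ext/L1_measurable/density_L1.
apply/integrableP; split => //.
have /integrableP[mg] := ig; apply: le_lt_trans.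
apply: ae_ge0_le_integral => //; [exact: measurableT_comp|exact: measurableT_comp|].
have q0 := density_ge0 QP; have aq := density_leZl QP Q'P aQ.
have bq := density_leZr QP Q'P bQ.
apply: filterS3 q0 aq bq => w; rewrite -/(q w) -/(q' w) => q0 aq bq _.
have h0 : 0 <= h w.
  by rewrite /h !(addr_ge0, mulr_ge0)// ltW.
have g0 : (0 <= g w)%E.
  by rewrite /g adde_ge0 ?lee_fin// mule_ge0// lee_fin (le_trans ler01).
rewrite (gee0_abs g0) /g /Phi_ext.
have [qw0|qw0] := ltP 0 (q w); last first.
  have -> : 0 < q' w = false.
    apply/negbTE; rewrite -leNgt (le_trans bq)// mulr_ge0_le0//.
    by rewrite (le_trans (ltW a0)).
  by rewrite lee_paddr ?lee_fin// lee_pemull.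
have q'w0 : 0 < q' w by rewrite (lt_le_trans _ aq)// mulr_gt0.
rewrite q'w0 /= -EFinM -EFinD lee_fin.
have lab : a <= q' w / q w <= b by rewrite ler_pdivlMr// aq ler_pdivrMr.
have := growth _ _ qw0 lab; rewrite divfK ?gt_eqF// => Hg.
have HA := PhiAB _ q'w0.
have qn : q w <= `|q w| by exact: ler_norm.
have q'n : q' w <= `|q' w| by exact: ler_norm.
have Hpos : Num.max (Phi (q w)) 0 <= `|Phi (q w)|.
  by rewrite ge_max ler_norm normr_ge0.
have H1 : Phi (q' w) <= Num.max (Phi (q' w)) 0 by rewrite le_max lexx.
have H2 : alpha * Num.max (Phi (q w)) 0 <= al * `|Phi (q w)|.
  by apply: ler_pM => //; [exact: ltW|rewrite le_max lexx orbT].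
have H3 : beta * (q w + 1) <= beta * (`|q w| + 1) by rewrite ler_pM2l// lerD2r.
have H4 : B * q' w <= B * `|q' w| by rewrite ler_wpM2l.
have H5 : 0 <= al * `|Phi (q w)| by rewrite mulr_ge0// (le_trans ler01).
have H6 : 0 <= beta * (`|q w| + 1) by rewrite mulr_ge0// ?addr_ge0// ltW.
have H7 : 0 <= A + B * `|q' w| by rewrite addr_ge0// mulr_ge0.
rewrite ler_norml /h; apply/andP; split; lra.
Qed.

End densities.

(** * Separation from the closed cone *)

Section separation.
Context {R : realType} {disp : measure_display} {Omega : measurableType disp}.
Variables (P : probability Omega R) (K : set (Omega -> R)).
Hypothesis K0 : K (fun=> 0).
Hypothesis KD : forall g h, K g -> K h -> K (fun w => g w + h w).
Hypothesis KZ : forall c g, 0 <= c -> K g -> K (fun w => c * g w).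

Lemma null_dominates_ae (Q : probability Omega R) (S : Omega -> Prop) :
  Q `<< P -> {ae P, forall w, S w} -> {ae Q, forall w, S w}.
Proof.
move=> QP [A [mA PA SA]]; exists A; split => //.
by move/null_content_dominatesP : QP; apply.
Qed.

Section superhedging_distance.
Variable Q : probability Omega R.
Hypothesis KQ : K `<=` L1 Q.
Local Notation E := (Rintegral Q setT).

(** The $L^1(Q)$-distance to $K - L^1_+(Q)$: the best correction of [g] towards
    [u] from below is [min(u, g)], leaving the positive part of [u - g]. *)
Definition cone_dist (u : Omega -> R) : R :=
  inf [set E (fun w => Num.max (u w - g w) 0) | g in K].

Let lb_cone_dist u :
  has_lbound [set E (fun w => Num.max (u w - g w) 0) | g in K].
Proof.
by exists 0 => _ [g _ <-]; apply: Rint_ge0 => w; rewrite le_max lexx orbT.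
Qed.

Let iE u g : L1 Q u -> K g -> L1 Q (fun w => Num.max (u w - g w) 0).
Proof. by move=> iu Kg; apply/L1_max0/L1B => //; exact: KQ. Qed.

Lemma cone_dist_le u g : K g -> cone_dist u <= E (fun w => Num.max (u w - g w) 0).
Proof. by move=> Kg; apply: ge_inf => //; exists g. Qed.

Lemma cone_dist_sublinear :
  sublinear_on (L1 Q : set (Omega -> R^o)) cone_dist.
Proof.
have ne u : [set E (fun w => Num.max (u w - g w) 0) | g in K] !=set0.
  by eexists; exists (fun=> 0).
split=> [u v iu iv|c u c0 iu].
  apply: inf_leD => // _ _ [g Kg <-] [h Kh <-]; eexists.
    by exists (fun w => g w + h w); [exact: KD|reflexivity].
  have Kgh := KD Kg Kh.
  rewrite -RintD//; try exact: iE.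
  apply: le_Rint.
  - by apply: iE => //; exact: L1D.
  - by apply: L1D; exact: iE.
  - move=> w; rewrite ge_max; apply/andP; split; last first.
      by rewrite addr_ge0// le_max lexx orbT.
    have -> : (u + v) w - (g w + h w) = (u w - g w) + (v w - h w).
      by rewrite opprD addrACA.
    by rewrite lerD// le_max lexx.
apply: inf_leM => // _ [g Kg <-]; eexists.
  by exists (fun w => c * g w); [exact: KZ|reflexivity].
rewrite -RintZ; last exact: iE.
apply: le_Rint.
- by apply: iE; [exact: L1Z|exact: KZ].
- exact/L1Z/iE.
- move=> w; have -> : (c *: (u : Omega -> R^o)) w - c * g w = c * (u w - g w).
    by rewrite mulrBr.
  by rewrite maxr_pMr// mulr0.
Qed.

Lemma cone_dist_le0_closure u : L1 Q u -> cone_dist u <= 0 ->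
  closureL1 Q (minus_L1plus Q K) u.
Proof.
move=> iu du; split => // eps eps0.
have ne : [set E (fun w => Num.max (u w - g w) 0) | g in K] !=set0.
  by eexists; exists (fun=> 0).
have [_ [g Kg <-] Eg] := inf_lt ne (le_lt_trans du eps0).
exists (g \- (fun w => Num.max (g w - u w) 0)).
  exists g => //; exists (fun w => Num.max (g w - u w) 0) => //.
  split; first by apply/L1_max0/L1B => //; exact: KQ.
  by apply: aeW => w; rewrite le_max lexx orbT.
rewrite Lnorm1 (eq_integral (fun w => (Num.max (u w - g w) 0)%:E)); last first.
  move=> w _ /=; congr EFin; have [ug|gu] := leP (u w) (g w).
    by rewrite max_l ?subr_ge0// max_r ?subr_le0// subKr subrr normr0.
  have ug0 : 0 <= u w - g w by rewrite subr_ge0 ltW.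
  by rewrite [Num.max (g w - u w) 0]max_r ?subr_le0 ?ltW// subr0 max_l// ger0_norm.
have := integrable_fin_num measurableT (iE iu Kg) => /fineK <-.
by rewrite lte_fin.
Qed.

End superhedging_distance.

(** The functional lies below the distance, which vanishes on [K] and is at most
    $E_Q[v^+]$ because $0 \in K$; this yields all the bounds. *)
Lemma separating_functional (Q : probability Omega R) u :
  K `<=` L1 Q -> L1 Q u -> ~ closureL1 Q (minus_L1plus Q K) u ->
  exists phi : (Omega -> R) -> R,
  [/\ (forall v v', L1 Q v -> L1 Q v' -> phi (fun w => v w + v' w) = phi v + phi v'),
      (forall c v, L1 Q v -> phi (fun w => c * v w) = c * phi v),
      (forall v, L1 Q v -> (forall w, 0 <= v w) -> 0 <= phi v <= Rintegral Q setT v),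
      (forall g, K g -> phi g <= 0) & 0 < phi u].
Proof.
move=> KQ iu ncl; have du : 0 < cone_dist Q u.
  by rewrite ltNge; apply/negP => du; apply: ncl; exact: cone_dist_le0_closure.
have [|||||phi [phiD phiZ phid phiu]] :=
    @hahn_banach R (Omega -> R^o) (L1 Q) _ _ _ (cone_dist Q) u.
- exact: L1_cst.
- by move=> v v' iv iv'; exact: L1D.
- by move=> c v iv; exact: L1Z.
- exact: cone_dist_sublinear.
- exact: iu.
have phi_le v : L1 Q v -> phi v <= Rintegral Q setT (fun w => Num.max (v w) 0).
  move=> iv; rewrite (le_trans (phid v iv))// (le_trans (cone_dist_le Q v K0))//.
  by under eq_Rintegral do rewrite subr0.
exists phi; split => //.
- move=> v iv v0; apply/andP; split.
    rewrite -oppr_le0 -mulN1r -(phiZ (-1) v iv).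
    rewrite (le_trans (phi_le _ (L1Z (-1) iv)))//.
    rewrite (_ : (fun w => _) = fun=> 0) ?Rint_cst//.
    by apply/funext => w; rewrite max_r// mulN1r oppr_le0.
  rewrite (le_trans (phi_le _ iv))// le_eqVlt; apply/orP; left; apply/eqP.
  by congr (Rintegral _ _ _); apply/funext => w; rewrite max_l.
- move=> g Kg; rewrite (le_trans (phid g (KQ _ Kg)))//.
  rewrite (le_trans (cone_dist_le Q g Kg))//.
  rewrite (_ : (fun w => _) = fun=> 0) ?Rint_cst//.
  by apply/funext => w; rewrite subrr maxxx.
- by rewrite phiu.
Qed.

(** Mixing a little of [Q] into the separating functional keeps it positive at
    [u] and bounds the resulting measure from below by a multiple of [Q]. *)
Lemma separating_measure (Q : probability Omega R) u :
  K `<=` L1 Q -> (forall g, K g -> Rintegral Q setT g <= 0) ->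
  L1 Q u -> ~ closureL1 Q (minus_L1plus Q K) u ->
  exists (Q' : probability Omega R) (a b : R), [/\ 0 < a, a <= b,
    (forall A, measurable A -> (a%:E * Q A <= Q' A <= b%:E * Q A)%E),
    (forall v, L1 Q v -> L1 Q' v) &
    (forall g, K g -> Rintegral Q' setT g <= 0) /\ 0 < Rintegral Q' setT u].
Proof.
move=> KQ EK iu ncl; have [phi [phiD phiZ phib phiK phiu]] :=
  separating_functional KQ iu ncl.
pose E := Rintegral Q setT.
(* A weight of [Q] small enough not to spoil the strict inequality at [u]. *)
have [e e0 eu] : exists2 e, 0 < e & e * `|E u| < phi u.
  have Eu1 : 0 < `|E u| + 1 by rewrite ltr_wpDl.
  exists (phi u / (`|E u| + 1)); first by rewrite divr_gt0.
  by rewrite mulrAC ltr_pdivrMr// ltr_pM2l// ltrDl.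
have phi1 : 0 <= phi (fun=> 1) by have /andP[] := phib _ (L1_cst Q 1) (fun=> ler01).
have [m mE m0] : exists2 m, m = phi (fun=> 1) + e & 0 < m.
  by exists (phi (fun=> 1) + e) => //; rewrite ltr_wpDl.
pose psi v := m^-1 * (phi v + e * E v).
have psi_bounds v : L1 Q v -> (forall w, 0 <= v w) ->
    (e / m) * E v <= psi v <= ((1 + e) / m) * E v.
  move=> iv v0; have /andP[p0 pE] := phib v iv v0.
  rewrite /psi [e / m]mulrC [(1 + e) / m]mulrC -!mulrA !ler_pM2l ?invr_gt0//.
  by rewrite lerDr p0 mulrDl mul1r lerD2r.
have E0 v : (forall w, 0 <= v w) -> 0 <= E v by move=> v0; exact: Rint_ge0.
have [|||||Q' Q'psi] := @functional_representation _ _ _ Q psi ((1 + e) / m).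
- by move=> v v' iv iv'; rewrite /psi phiD// /E RintD// [e * _]mulrDr addrACA mulrDr.
- move=> c v iv; rewrite /psi phiZ// /E RintZ// [e * _]mulrCA -mulrDr.
  by rewrite mulrCA.
- move=> v iv v0; have /andP[+ _] := psi_bounds v iv v0; apply: le_trans.
  by rewrite mulr_ge0 ?E0// divr_ge0// ltW.
- by move=> v iv v0; have /andP[] := psi_bounds v iv v0.
- by rewrite /psi /E Rint_cst mulr1 -mE mulVf// gt_eqF.
have Q'A A : measurable A -> Q' A = (psi \1_A)%:E.
  by move=> mA; rewrite -(Q'psi _ (L1_indic Q mA)).2 Rint_indic.
exists Q', (e / m), ((1 + e) / m); split.
- by rewrite divr_gt0.
- by rewrite ler_pM2r ?invr_gt0// lerDr.
- move=> A mA; rewrite Q'A// -(Rint_indic Q mA) -!EFinM !lee_fin.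
  by apply: psi_bounds => //; exact: L1_indic.
- by move=> v iv; exact: (Q'psi v iv).1.
split=> [g Kg|].
  rewrite (Q'psi g (KQ _ Kg)).2 /psi pmulr_rle0 ?invr_gt0//.
  by rewrite -[leRHS]addr0 lerD ?phiK// pmulr_rle0// EK.
rewrite (Q'psi u iu).2 /psi mulr_gt0 ?invr_gt0// -ltrBlDr sub0r.
have Eu : - E u <= `|E u| by rewrite -normrN ler_norm.
by rewrite -mulrN (le_lt_trans (ler_wpM2l (ltW e0) Eu)).
Qed.

Variable Phi : R -> R.
Hypothesis Phi_convex : convex_function (E := R^o) `]0, +oo[ Phi.
Hypothesis Phi_growth : growth_condition Phi.

Lemma M_Phi_separation (Q : probability Omega R) u :
  M_Phi P Phi K Q -> L1 Q u -> ~ closureL1 Q (minus_L1plus Q K) u ->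
  exists Q' : probability Omega R,
    [/\ M_Phi P Phi K Q', L1 Q' u & 0 < Rintegral Q' setT u].
Proof.
move=> [[QP KQ EK] iPhi] iu ncl.
have EK' g : K g -> Rintegral Q setT g <= 0.
  by move=> Kg; rewrite -lee_fin -expectation_Rint ?EK//; exact: KQ.
have [Q' [a [b [a0 ab QQ' L1Q' [Q'K Q'u]]]]] := separating_measure KQ EK' iu ncl.
have Q'P : Q' `<< P.
  apply/null_content_dominatesP => A mA PA0.
  have QA0 : Q A = 0%E by move/null_content_dominatesP : QP; exact.
  have /andP[_] := QQ' A mA; rewrite QA0 mule0 => Q'A0.
  by apply/eqP; rewrite eq_le Q'A0 measure_ge0.
exists Q'; split; [split; [split|]|exact: L1Q'|exact: Q'u] => //.
- by move=> g /KQ /L1Q'.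
- move=> g Kg; rewrite expectation_Rint ?lee_fin ?Q'K//.
  exact/L1Q'/KQ.
- apply: (Phi_ext_integrable_comparable Phi_convex Phi_growth QP Q'P a0 ab _ _ iPhi).
    by move=> A /QQ' /andP[].
  by move=> A /QQ' /andP[].
Qed.

Lemma closureL1_expectation_le0 (Q : probability Omega R) u :
  M1 P K Q -> closureL1 Q (minus_L1plus Q K) u -> Rintegral Q setT u <= 0.
Proof.
move=> [QP KQ EK] [iu ucl]; apply/ler_addgt0Pl => eps eps0; rewrite addr0.
have [_ [g Kg [h [ih h0] <-]]] := ucl eps eps0.
have iug : L1 Q (fun w => u w - (g w - h w)) by apply: L1B iu (L1B (KQ _ Kg) ih).
rewrite Lnorm1 => dist.
have -> : u = (fun w => (u w - (g w - h w)) + (g w - h w)).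
  by apply/funext => w; rewrite subrK.
rewrite RintD//; last exact: L1B (KQ _ Kg) ih.
rewrite (RintB (KQ _ Kg) ih).
have g0 : Rintegral Q setT g <= 0.
  by rewrite -lee_fin -expectation_Rint ?EK//; exact: KQ.
have h0' : 0 <= Rintegral Q setT h.
  by rewrite -(Rint_cst Q 0); apply: ae_le_Rint => //; exact: L1_cst.
have : Rintegral Q setT (fun w => u w - (g w - h w)) <= eps.
  rewrite (le_trans (ler_norm _))// (le_trans (le_normr_Rintegral measurableT iug))//.
  rewrite -lee_fin /Rintegral fineK; first exact: ltW dist.
  exact: (integrable_fin_num measurableT (L1_norm iug)).
move=> le_eps; rewrite -[leRHS]addr0 lerD// subr_le0.
exact: le_trans g0 h0'.
Qed.

End separation.

(** * The duality formula *)

Theorem theorem5 (R : realType) (disp : measure_display)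
    (Omega : measurableType disp) (P : probability Omega R)
    (T : R) (T_gt0 : 0 < T) (F : R -> set (set Omega))
    (F_filtration : filtration T F) (F_usual : usual_conditions P T F)
    (d : nat) (X : R -> Omega -> 'rV[R]_d)
    (X_cadlag : forall i, cadlag T (fun t w => X t w ord0 i))
    (X_semimartingale : semimartingale P T F X)
    (Phi : R -> R)
    (Phi_convex : convex_function (E := R^o) `]0, +oo[ Phi)
    (Phi_growth : growth_condition Phi)
    (Phi0_finite : (lim ((Phi y)%:E @[y --> 0^'+]) < +oo)%E)
    (M_Phi_P : M_Phi P Phi (K_set P T F X) `&` equivalent_probabilities P
               !=set0)
    (f : Omega -> R) (f_L0 : L0 f)
    (f_L1 : forall Q, M_Phi P Phi (K_set P T F X) Q -> L1 Q f) :
  f_hat_Phi P Phi (K_set P T F X) f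
    = ereal_sup [set 'E_Q[f]%E | Q in M_Phi P Phi (K_set P T F X)] /\
  (ereal_sup [set 'E_Q[f]%E | Q in M_Phi P Phi (K_set P T F X)]
    <= f_hat P (K_set P T F X) f)%E.
Proof.
have T_ge0 := ltW T_gt0.
set K := K_set P T F X in M_Phi_P f_L1 *.
have K0 : K (fun=> 0) by exact: K_set0.
have KD g h : K g -> K h -> K (fun w => g w + h w) by exact: K_setD.
have KZ c g : 0 <= c -> K g -> K (fun w => c * g w) by exact: K_setZ.
set S := [set 'E_Q[f]%E | Q in M_Phi P Phi K].
have f_shift Q x : M_Phi P Phi K Q -> L1 Q (fun w => f w - x).
  by move=> MQ; apply: L1B; [exact: f_L1|exact: L1_cst].
have E_shift Q x : M_Phi P Phi K Q ->
    Rintegral Q setT (fun w => f w - x) = Rintegral Q setT f - x.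
  move=> MQ; rewrite (RintB (f_L1 Q MQ) (L1_cst Q x)); congr (_ - _).
  exact: Rint_cst.
have E_le Q x : M_Phi P Phi K Q ->
    Rintegral Q setT (fun w => f w - x) <= 0 -> ('E_Q[f] <= x%:E)%E.
  move=> MQ; rewrite E_shift// subr_le0 => ?.
  by rewrite expectation_Rint ?lee_fin//; exact: f_L1.
split.
  apply/eqP; rewrite eq_le; apply/andP; split; last first.
    apply: le_ereal_inf_tmp => _ [x xcl <-]; apply: ge_ereal_sup => _ [Q MQ <-].
    apply: E_le => //; exact: (closureL1_expectation_le0 MQ.1 (xcl Q MQ)).
  have [Q0 [MQ0 _]] := M_Phi_P.
  have SQ Q : M_Phi P Phi K Q -> ((Rintegral Q setT f)%:E <= ereal_sup S)%E.
    move=> MQ; apply: ereal_sup_ubound; exists Q => //.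
    by rewrite expectation_Rint//; exact: f_L1.
  case supS : (ereal_sup S) => [s| |]; [|by rewrite leey|]; last first.
    by have := SQ _ MQ0; rewrite supS leeNy_eq.
  apply: ereal_inf_lbound; exists s => //= Q MQ; apply: contrapT => ncl.
  have [Q' [MQ' _ Q'f]] :=
    M_Phi_separation K0 KD KZ Phi_convex Phi_growth MQ (f_shift Q s MQ) ncl.
  have := SQ _ MQ'; rewrite supS lee_fin leNgt => /negP; apply.
  by move: Q'f; rewrite E_shift// subr_gt0.
apply: le_ereal_inf_tmp => _ [x [_ [g Kg fg]] <-]; apply: ge_ereal_sup => _ [Q MQ <-].
apply: E_le => //; have [[QP KQ EK] _] := MQ.
apply: (@le_trans _ _ (Rintegral Q setT g)).
  by apply: ae_le_Rint; [exact: f_shift|exact: KQ|exact: null_dominates_ae fg].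
by rewrite -lee_fin -expectation_Rint ?EK//; exact: KQ.
Qed.
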